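(* Let $\mathbb{F}$ be any field. There is, up to isomorphism, a unique nilpotent symplectic alternating algebra $L$ over $\mathbb{F}$ of dimension $10$ with an isotropic center of dimension $2$ that is of class $7$ and has the further properties that $L^4L^3\neq L^7$ and $L^5L^2\not\leq L^4L^3$. This algebra can be given by the presentation $$\mathcal{P}_{10}^{(2,7)}:\quad (x_2y_3,y_5)=1,\ (x_3y_4,y_5)=1,\ (x_1y_2,y_4)=1,\ (y_1y_2,y_3)=1.$$
   Context: A symplectic alternating algebra (SAA) over a field $\mathbb{F}$ is a finite-dimensional vector space $L$ over $\mathbb{F}$ with a non-degenerate alternating bilinear form $(\ ,\ )$ and a bilinear product $\cdot$ satisfying $u\cdot u=0$ for all $u$ and $(u\cdot v,w)=(v\cdot w,u)$ for all $u,v,w\in L$. No associativity or Jacobi identity is assumed. The map $(u,v,w)\mapsto(uv,w)$ is then an alternating trilinear form. A standard basis (in dimension $10$) is a basis $x_1,y_1,\ldots,x_5,y_5$ with $(x_i,x_j)=(y_i,y_j)=0$ and $(x_i,y_j)=\delta_{ij}$ for all $i,j$. Presentations: $L$ is given by a presentation if there is a standard basis for which the listed values of triples $(uv,w)$ hold and $(uv,w)=0$ for all triples of basis elements that are not a reordering of a listed one. Isomorphisms are linear bijections preserving product and form. For subspaces $U,V$, $UV$ is the span of all products $uv$. $L^1=L$, $L^{m+1}=L^mL$. $L$ is nilpotent if $L^{m+1}=\{0\}$ for some $m\ge 0$, and the smallest such $m$ is its (nilpotence) class. The center is $Z(L)=\{x\in L:xL=\{0\}\}$; it is isotropic if $(u,v)=0$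 for all $u,v\in Z(L)$. *)

(* Defs.v *)
From HB Require Import structures.
From mathcomp Require Import all_boot all_order all_algebra.

Set Implicit Arguments.
Unset Strict Implicit.
Unset Printing Implicit Defensive.

Import GRing.Theory.
Local Open Scope ring_scope.

Declare Scope saa_scope.
Delimit Scope saa_scope with saa.
Open Scope saa_scope.

(* An alternating form is skew-symmetric, so its left and right radicals
   coincide and nondegeneracy need only be required on one side. *)
Record saa (F : fieldType) := Saa {
  saa_sort :> vectType F;
  saa_form : {biscalar saa_sort};
  saa_mul : {bilinear saa_sort -> saa_sort -> saa_sort};
  saa_form_alt : forall u, saa_form u u = 0;
  saa_form_nondeg : forall u, (forall v, saa_form u v = 0) -> u = 0;
  saa_mul_alt : forall u, saa_mul u u = 0;
  saa_mul_cyc : forall u v w,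
    saa_form (saa_mul u v) w = saa_form (saa_mul v w) u
}.

Notation "''(' u , v )" := (saa_form _ u v)
  (at level 0, format "''(' u ,  v )") : saa_scope.
Notation "u ** v" := (saa_mul _ u v)
  (at level 40, left associativity) : saa_scope.

Section Algebra.
Variables (F : fieldType) (L : saa F).
Implicit Types (u v w x : L) (U V W : {vspace L}).

(* Bases suffice by bilinearity, see saa_prodvP (compare falgebra.prodv). *)
Definition saa_prodv U V : {vspace L} :=
  <<[seq u ** v | u <- vbasis U, v <- vbasis V]>>%VS.

Lemma saa_memv_mul U V u v : u \in U -> v \in V -> u ** v \in saa_prodv U V.
Proof.
move=> /coord_vbasis-> /coord_vbasis->.
rewrite linear_sumlz; apply: memv_suml => i _.
rewrite linear_sumr; apply: memv_suml => j _.
rewrite linearZl_LR linearZr_LR !memvZ // memv_span //.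
by apply: allpairs_f; rewrite memt_nth.
Qed.

Lemma saa_prodvP U V W :
  reflect {in U & V, forall u v, u ** v \in W} (saa_prodv U V <= W)%VS.
Proof.
apply: (iffP idP) => [sW u v Uu Vv | sW].
  by apply: (subvP sW); apply: saa_memv_mul.
apply/span_subvP => _ /allpairsP[[u v] /= [Uu Vv ->]].
by rewrite sW ?vbasis_mem.
Qed.

(* saa_pow m is L^m for m >= 1; the value at 0 is irrelevant. *)
Definition saa_pow (m : nat) : {vspace L} :=
  iter m.-1 (fun U => saa_prodv U fullv) fullv.

Definition saa_nilpotent := exists m, saa_pow m.+1 = 0%VS.

Definition saa_class (c : nat) :=
  saa_pow c.+1 = 0%VS /\ forall m, saa_pow m.+1 = 0%VS -> (c <= m)%N.

Definition saa_lmul (x : L) : 'End(L) := linfun (saa_mul L x).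

Fact saa_lmul_linear : linear saa_lmul.
Proof.
move=> a u v; apply/lfunP => w.
by rewrite add_lfunE scale_lfunE !lfunE /= linearPl.
Qed.

HB.instance Definition _ :=
  GRing.isLinear.Build F L 'End(L) _ saa_lmul saa_lmul_linear.

Definition saa_center : {vspace L} := lker (linfun saa_lmul).

Lemma saa_centerP x : reflect (forall u, x ** u = 0) (x \in saa_center).
Proof.
rewrite memv_ker lfunE /=; apply: (iffP eqP) => [/lfunP x0 u | x0].
  by have := x0 u; rewrite !lfunE.
by apply/lfunP => u; rewrite !lfunE /= x0.
Qed.

Definition saa_isotropic U := {in U &, forall u v, '(u, v) = 0}.

End Algebra.

Arguments saa_center {F} L.
Arguments saa_pow {F} L m.
Arguments saa_nilpotent {F} L.
Arguments saa_class {F} L c.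

Notation "U *v V" := (saa_prodv U V)
  (at level 40, left associativity) : saa_scope.

Definition saa_isomorphic (F : fieldType) (L M : saa F) :=
  exists f : {linear L -> M},
    [/\ bijective f,
        forall u v, f (u ** v) = f u ** f v
      & forall u v, '(f u, f v) = '(u, v)].

(* inl i indexes x_(i+1) and inr i indexes y_(i+1). *)
Definition sb_index (n : nat) : finType := ('I_n + 'I_n)%type.

Definition standard_basis (F : fieldType) (L : saa F) (n : nat)
    (b : sb_index n -> L) :=
  [/\ basis_of fullv (codom b),
      forall i j, '(b (inl i), b (inl j)) = 0,
      forall i j, '(b (inr i), b (inr j)) = 0
    & forall i j, '(b (inl i), b (inr j)) = (i == j)%:R].

(* (i, j, k, c) stands for the relation (b_i b_j, b_k) = c. *)
Definition presentation (F : fieldType) (n : nat) :=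
  seq (sb_index n * sb_index n * sb_index n * F).

Definition saa_presented_by (F : fieldType) (n : nat) (P : presentation F n)
    (L : saa F) :=
  exists b : sb_index n -> L,
    [/\ standard_basis b,
        forall i j k c, (i, j, k, c) \in P -> '(b i ** b j, b k) = c
      & forall i j k,
          (forall i' j' k' c, (i', j', k', c) \in P ->
             ~~ perm_eq [:: i; j; k] [:: i'; j'; k']) ->
          '(b i ** b j, b k) = 0].

Notation "''x_' i" := (inl (@Ordinal 5 i.-1 isT) : sb_index 5)
  (at level 8, i at level 2, only parsing) : saa_scope.
Notation "''y_' i" := (inr (@Ordinal 5 i.-1 isT) : sb_index 5)
  (at level 8, i at level 2, only parsing) : saa_scope.

Definition P10_2_7 (F : fieldType) : presentation F 5 :=
  [:: ('x_2, 'y_3, 'y_5, 1); ('x_3, 'y_4, 'y_5, 1);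
      ('x_1, 'y_2, 'y_4, 1); ('y_1, 'y_2, 'y_3, 1)].

(* Main.v *)
From HB Require Import structures.
From mathcomp Require Import all_boot all_order all_algebra zify ring.
Require Import Defs.

Set Implicit Arguments.
Unset Strict Implicit.
Unset Printing Implicit Defensive.

Import GRing.Theory.
Local Open Scope ring_scope.

(** Write T(u,v,w) for the alternating trilinear form (uv,w), and weigh the
    standard basis of the presentation by
      y4, y5 : 1,  y3 : 2,  y2 : 3,  x1, y1 : 4,  x2 : 5,  x3 : 6,  x4, x5 : 7.

    The presented algebra.  It is realised on F^10: take T to be the sum of the
    3 x 3 minors that the listed triples select, and let the product be the one
    that T defines through the form ([model]).  Any two distinct entries of a
    listed triple have weights of sum at most 7, so that L^m lies in the span of the basis elements of weight at least m; the
    products y5 y4 = y3, y5 y3 = y2, y4 y2 = y1, y2 y3 = x1, ... show that it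
    is equal to that span, and all the required properties can be read off
    ([presented_characterized]).  Two algebras with the same presentation are
    isomorphic, because T is determined on bases ([presented_isomorphic]).

    Uniqueness.  Let L have the stated properties.  Since T can be moved
    around cyclically, (L^i, L^j) = 0 for i + j >= 9 and L^i L^j = 0 for
    i + j >= 8.  Counting dimensions against orthogonal complements forces
    the dimensions 10, 8, 7, 6, 4, 3, 2 of L^1, ..., L^7, and then
    L^4 and L^5 are orthogonal complements of each other ([dim_pow_4_5]), so
    that L^4 / L^5 is a symplectic plane.  Since L / L^2 is a plane and
    L^3 / L^4 a line, there are a and b that span L modulo L^2 and satisfy
    a L^2 <= L^4.

    In the presented algebra all basis elements are words in a = y4 and
    b = y5, so the task is to find a and b in L for which these words
    satisfy the relations.  What has to be true is that
      (x1,y1) = 1,  y5 y2 and y4 y3 lie in L^5,  (y4 y3, y2) = 0,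
      (y4,y5) = 0;
    everything else follows from the weights and the cyclic symmetry of T
    ([word_presented]).  That L^5 L^2 is not contained in L^4 L^3 is what
    makes (x1,y1) nonzero for all such a and b ([x1_y1_neq0]); otherwise L^4
    would be isotropic.  Once (x1,y1) is nonzero, adding to a and b suitable
    multiples of words of at least the same weight changes the remaining
    obstructions one after the other by multiples of (x1,y1), with coefficient
    1 or -1, so that they can be killed over any field.  Replacing (a,b) by (s a, b / s) divides (x1,y1)
    by s, so that no root has to be extracted to make it 1
    ([exists_normal_generators]). *)

(** * Identities, orthogonal complements and powers *)

Lemma dim_rV_vspace (F : fieldType) n (U : {vspace 'rV[F]_n}) : (\dim U <= n)%N.
Proof. by apply: leq_trans (dimvS (subvf U)) _; rewrite dimvf [dim _]dim_matrix mul1r. Qed.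

Lemma vline_addv_codim1 (F : fieldType) (vT : vectType F) (U V : {vspace vT}) w :
  (U <= V)%VS -> (\dim V <= (\dim U).+1)%N -> w \in V -> w \notin U ->
  V = (<[w]> + U)%VS.
Proof.
move=> sUV dV wV wU; apply/esym/eqP; rewrite eqEdim subv_add -memvE wV sUV /=.
apply: leq_trans dV _; rewrite ltn_neqAle dimvS ?addvSr // andbT.
apply: contra wU => /eqP dE.
have -> : U = (<[w]> + U)%VS by apply/eqP; rewrite eqEdim addvSr -dE leqnn.
by rewrite (subvP (addvSl _ _)) ?memv_line.
Qed.

Section Identities.
Variables (F : fieldType) (L : saa F).
Implicit Types (u v w : L) (U V : {vspace L}).

Lemma form_skew u v : '(u, v) = - '(v, u).
Proof.
apply/eqP; rewrite -addr_eq0; apply/eqP.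
by have := saa_form_alt (u + v); rewrite linearDl !linearDr /= !saa_form_alt add0r addr0.
Qed.

Lemma mul_skew u v : u ** v = - (v ** u).
Proof.
apply/eqP; rewrite -addr_eq0; apply/eqP.
by have := saa_mul_alt (u + v); rewrite linearDl !linearDr /= !saa_mul_alt add0r addr0.
Qed.

Lemma tri_cyc u v w : '(u ** v, w) = '(v ** w, u).
Proof. exact: saa_mul_cyc. Qed.

Lemma tri_swap12 u v w : '(v ** u, w) = - '(u ** v, w).
Proof. by rewrite mul_skew linearNl. Qed.

Lemma tri_swap23 u v w : '(u ** w, v) = - '(u ** v, w).
Proof. by rewrite -tri_cyc tri_swap12. Qed.

Lemma tri_alt13 u v : '(u ** v, u) = 0.
Proof. by rewrite tri_cyc -tri_cyc -tri_cyc saa_mul_alt linear0l. Qed.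

Lemma tri_alt23 u v : '(u ** v, v) = 0.
Proof. by rewrite tri_cyc saa_mul_alt linear0l. Qed.

(** The pairings of u with a basis of U: the orthogonal complement of U is the
    kernel of this map, which is what makes its dimension accessible. *)
Definition gram_row U u : 'rV[F]_(\dim U) := \row_i '(u, (vbasis U)`_i).

Lemma gram_row_linear U : linear (gram_row U).
Proof. by move=> k u v; apply/rowP => i; rewrite !mxE linearPl. Qed.

HB.instance Definition _ U :=
  GRing.isLinear.Build F L 'rV[F]_(\dim U) _ (gram_row U) (gram_row_linear U).

Definition orth U : {vspace L} := lker (linfun (gram_row U)).

Lemma orthP U u : reflect {in U, forall v, '(u, v) = 0} (u \in orth U).
Proof.
rewrite memv_ker lfunE /=; apply: (iffP eqP) => [/rowP u0 v /coord_vbasis-> | u0].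
  rewrite linear_sumr big1 //= => i _.
  by have := u0 i; rewrite !mxE linearZr_LR /= => ->; rewrite mulr0.
by apply/rowP => i; rewrite !mxE u0 // vbasis_mem // mem_nth // size_tuple.
Qed.

Lemma leq_dim_orth U : (\dim (fullv : {vspace L}) <= \dim U + \dim (orth U))%N.
Proof.
rewrite -(limg_ker_dim (linfun (gram_row U)) fullv) capfv addnC leq_add2r.
exact: dim_rV_vspace.
Qed.

(** The lower bound is rank-nullity.  For the upper one, U embeds in the dual of
    a complement of its orthogonal: a vector of U that is orthogonal to this
    complement is orthogonal to everything. *)
Lemma dim_orth U : \dim (orth U) = (\dim (fullv : {vspace L}) - \dim U)%N.
Proof.
apply/eqP; rewrite eqn_leq leq_subLR leq_dim_orth andbT.
set W := orth U.
have WC0 : (U :&: lker (linfun (gram_row (W^C))) = 0)%VS.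
  apply/eqP; rewrite -subv0; apply/subvP => u; rewrite memv_cap => /andP[Uu /orthP uC].
  rewrite memv0; apply/eqP/saa_form_nondeg => v.
  have: v \in (W + W^C)%VS by rewrite addv_complf memvf.
  case/memv_addP => [w Ww [c /uC uc0 ->]].
  by rewrite linearDr /= uc0 addr0 form_skew (orthP _ _ Ww) ?oppr0.
have := limg_dim_eq WC0; set h := (_ @: U)%VS => dU.
have : (\dim U <= \dim (W^C)%VS)%N.
  by rewrite -dU; apply: dim_rV_vspace.
rewrite dimv_compl => leU; rewrite leq_subRL ?dimvS ?subvf // addnC.
by rewrite -leq_subRL ?dimvS ?subvf.
Qed.

Lemma orthK U : orth (orth U) = U.
Proof.
apply/esym/eqP; rewrite eqEdim !dim_orth subKn ?dimvS ?subvf // andbT.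
by apply/subvP => u Uu; apply/orthP => v /orthP v0; rewrite form_skew v0 ?oppr0.
Qed.

Lemma saa_powS m : saa_pow L m.+2 = saa_pow L m.+1 *v fullv.
Proof. by []. Qed.

Lemma saa_pow_mul m u v : u \in saa_pow L m.+1 -> u ** v \in saa_pow L m.+2.
Proof. by move=> um; rewrite saa_powS saa_memv_mul ?memvf. Qed.

Lemma saa_pow_lmul m u v : u \in saa_pow L m.+1 -> v ** u \in saa_pow L m.+2.
Proof. by move=> um; rewrite mul_skew memvN saa_pow_mul. Qed.

Lemma saa_powS_sub m : (saa_pow L m.+2 <= saa_pow L m.+1)%VS.
Proof.
elim: m => [|m IH]; first exact: subvf.
apply/saa_prodvP => u v um _; apply: saa_pow_mul; exact: (subvP IH).
Qed.

Lemma saa_pow_anti m n : (0 < m <= n)%N -> (saa_pow L n <= saa_pow L m)%VS.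
Proof.
case: m => // m /= /subnK <-.
elim: (n - m.+1)%N => [|k IH]; first by rewrite add0n.
by apply: subv_trans IH; rewrite addSn addnS; apply: saa_powS_sub.
Qed.

Lemma saa_pow_weaken m n u : (0 < m <= n)%N -> u \in saa_pow L n -> u \in saa_pow L m.
Proof. by move=> /saa_pow_anti/subvP; apply. Qed.

(** Moving one factor of v over to u, (u, v'w) = +-(uw, v'), trades a step down
    in the second power against a step up in the first. *)
Lemma form_pow0 i j u v : saa_pow L (i + j).+1 = 0%VS ->
  u \in saa_pow L i.+1 -> v \in saa_pow L j.+1 -> '(u, v) = 0.
Proof.
elim: j i u v => [|j IH] i u v pow0 ui vj.
  move: ui; rewrite addn0 in pow0; rewrite pow0 memv0 => /eqP->.
  by rewrite linear0l.
move: v vj.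
suff /subvP s : (saa_pow L j.+2 <= orth <[u]>)%VS.
  move=> v /s /orthP /(_ _ (memv_line u)) vu.
  by rewrite form_skew vu oppr0.
apply/saa_prodvP => v w vj _; apply/orthP => _ /vlineP[k ->].
by rewrite linearZr_LR /= tri_cyc (IH i.+1) ?mulr0 ?addSnnS ?saa_pow_lmul.
Qed.

Lemma tri_pow0 i j u v w : saa_pow L (i + j).+2 = 0%VS ->
  u \in saa_pow L i.+1 -> v \in saa_pow L j.+1 -> '(u ** v, w) = 0.
Proof.
by move=> pow0 ui vj; rewrite tri_cyc tri_cyc (@form_pow0 i.+1 j) ?saa_pow_lmul.
Qed.

Lemma mul_pow0 i j u v : saa_pow L (i + j).+2 = 0%VS ->
  u \in saa_pow L i.+1 -> v \in saa_pow L j.+1 -> u ** v = 0.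
Proof.
by move=> pow0 ui vj; apply: saa_form_nondeg => w; apply: tri_pow0 pow0 ui vj.
Qed.

(** xL = 0 means T(x,u,v) = 0 for all u and v, that is, x is orthogonal to all
    products. *)
Lemma center_orth : saa_center L = orth (saa_pow L 2).
Proof.
apply/vspaceP => x; apply/saa_centerP/orthP => [x0 | x0 u].
  move=> v; move: v; suff /subvP s : (saa_pow L 2 <= orth <[x]>)%VS.
    by move=> v /s /orthP /(_ _ (memv_line x)) vx; rewrite form_skew vx oppr0.
  apply/saa_prodvP => v w _ _; apply/orthP => _ /vlineP[k ->].
  by rewrite linearZr_LR /= -tri_cyc x0 linear0l mulr0.
apply: saa_form_nondeg => v.
by rewrite tri_cyc form_skew x0 ?oppr0 // saa_pow_mul ?memvf.
Qed.

End Identities.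

(** * The dimensions of the powers *)

Section Generators.
Variables (F : fieldType) (L : saa F).
Local Notation pow := (saa_pow L).

Definition generates2 (a b : L) := (fullv <= <[a]> + <[b]> + pow 2)%VS.

Lemma generates2P a b : reflect
  (forall v, exists k l, exists2 w, w \in pow 2 & v = k *: a + l *: b + w)
  (generates2 a b).
Proof.
apply: (iffP subvP) => [gen v | gen v _].
  have /memv_addP[_ /memv_addP[_ /vlineP[k ->] [_ /vlineP[l ->] ->]] [w w2 ->]] :=
    gen v (memvf v).
  by exists k, l, w.
have [k [l [w w2 ->]]] := gen v.
by rewrite !memv_add ?memvZ ?memv_line.
Qed.

(** Modulo L^3 the only product of two generators is b a. *)
Lemma pow2_gen a b v : generates2 a b -> v \in pow 2 ->
  exists k, exists2 w, w \in pow 3 & v = k *: (b ** a) + w.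
Proof.
move=> /generates2P gen v2.
suff /subvP/(_ v v2)/memv_addP[_ /vlineP[k ->] [w w3 ->]] :
  (pow 2 <= <[b ** a]> + pow 3)%VS by exists k, w.
apply/saa_prodvP => x y _ _.
have [k [l [w w2 ->]]] := gen x; have [k' [l' [w' w'2 ->]]] := gen y.
rewrite linearDr; apply: memvD; last first.
  by apply: (subvP (addvSr _ _)); apply: saa_pow_lmul.
rewrite linearDl; apply: memvD; last first.
  by apply: (subvP (addvSr _ _)); apply: saa_pow_mul.
(* (k a + l b)(k' a + l' b) = (l k' - k l') b a by alternation *)
apply: (subvP (addvSl _ _)); apply/vlineP; exists (l * k' - k * l').
rewrite linearDl !linearDr /= !linearZl_LR !linearZr_LR /= !saa_mul_alt.
by rewrite (mul_skew a b) !scaler0 add0r addr0 !scalerN !scalerA -scaleNr -scalerDl addrC.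
Qed.

Lemma dim_pow2 a b : generates2 a b -> (\dim (pow 2) <= (\dim (pow 3)).+1)%N.
Proof.
move=> gen; apply: leq_trans (_ : \dim (<[b ** a]> + pow 3) <= _)%N.
  apply: dimvS; apply/subvP => v /(pow2_gen gen)[k [w w3 ->]].
  by rewrite memv_add ?memvZ ?memv_line.
apply: leq_trans (dimv_add_leqif _ _).1 _.
by rewrite dim_vline -[(\dim (pow 3)).+1]add1n leq_add2r leq_b1.
Qed.

End Generators.

Section Class7.
Variables (F : fieldType) (L : saa F).
Hypotheses (dimL : \dim (fullv : {vspace L}) = 10%N).
Hypotheses (pow8 : saa_pow L 8 = 0%VS) (pow7 : saa_pow L 7 <> 0%VS).
Hypothesis (dimZ : \dim (saa_center L) = 2%N).
Local Notation pow := (saa_pow L).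

Lemma pow_ge8 n : (7 <= n)%N -> pow n.+1 = 0%VS.
Proof.
by move=> le7n; apply/eqP; rewrite -subv0 -pow8 saa_pow_anti.
Qed.

Lemma form0 i j u v : (9 <= i + j)%N -> (0 < i)%N -> (0 < j)%N ->
  u \in pow i -> v \in pow j -> '(u, v) = 0.
Proof.
case: i j => // i [|j] // le9 _ _; apply: form_pow0; apply: pow_ge8.
by move: le9; rewrite addSn addnS.
Qed.

Lemma mul0 i j u v : (8 <= i + j)%N -> (0 < i)%N -> (0 < j)%N ->
  u \in pow i -> v \in pow j -> u ** v = 0.
Proof.
case: i j => // i [|j] // le8 _ _; apply: mul_pow0; apply: pow_ge8.
by move: le8; rewrite addSn addnS.
Qed.

Lemma tri0 i j u v w : (8 <= i + j)%N -> (0 < i)%N -> (0 < j)%N ->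
  u \in pow i -> v \in pow j -> '(u ** v, w) = 0.
Proof. by move=> ? ? ? ui vj; rewrite (mul0 (i := i) (j := j)) ?linear0l. Qed.

Lemma dim_pow_2 : \dim (pow 2) = 8%N.
Proof.
have le10 : (\dim (pow 2) <= 10)%N by rewrite -dimL dimvS ?subvf.
by rewrite -(subKn le10) -dimL -dim_orth -center_orth dimZ dimL.
Qed.

Lemma exists_generates2 : exists a b : L, generates2 a b.
Proof.
have dC : \dim ((pow 2)^C)%VS = 2%N by rewrite dimv_compl dimL dim_pow_2.
have := vbasisP ((pow 2)^C)%VS; move: (vbasis _); rewrite dC => X /span_basis.
case: (tupleP X) => a Y; case: (tupleP Y) => b Z; rewrite (tuple0 Z) /=.
rewrite span_cons span_seq1 => spanC; exists a, b.
by rewrite /generates2 spanC addvC addv_complf.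
Qed.

Lemma exists_pow6_notin_center : exists2 t, t \in pow 6 & t \notin saa_center L.
Proof.
apply/subvPn; apply/negP => /subvP sub6Z; apply: pow7; apply/eqP.
rewrite -subv0; apply/saa_prodvP => u v /sub6Z/saa_centerP u0 _.
by rewrite u0 mem0v.
Qed.

(** Some t in L^6 is not central.  As t L^2 = 0 the form T(t,.,.) lives on the
    plane L / L^2, so it is nonzero on a pair of generators a, b.  Then ta and tb
    are independent elements of L^7, which is contained in the 2-dimensional
    center. *)
Lemma pow7_center : pow 7 = saa_center L.
Proof.
apply/esym/eqP; rewrite eq_sym eqEdim; apply/andP; split.
  apply/subvP => u u7; apply/saa_centerP => v.
  by apply: (mul0 (i := 7) (j := 1)); rewrite ?memvf.
have [t t6 tZ] := exists_pow6_notin_center.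
have [a [b /generates2P gen]] := exists_generates2.
have tl w : w \in pow 2 -> t ** w = 0 by move=> w2; apply: (mul0 (i := 6) (j := 2)).
have tab : '(t ** a, b) != 0.
  apply: contraNneq tZ => tab0; apply/saa_centerP => u.
  have [k [l [w w2 ->]]] := gen u.
  rewrite linearDr /= (tl w) // addr0; apply: saa_form_nondeg => v.
  have [k' [l' [w' w'2 ->]]] := gen v.
  rewrite linearDr /= [X in _ + X]tri_swap23 (tl w') // linear0l oppr0 addr0.
  rewrite !(linearDl, linearDr, linearZl_LR, linearZr_LR) /=.
  by rewrite !tri_alt23 (tri_swap23 t a b) tab0 oppr0 !(mulr0, addr0).
have freet : free [:: t ** a; t ** b].
  rewrite free_cons seq1_free span_seq1; apply/andP; split.
    apply: contra tab => /vlineP[k ->].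
    by rewrite linearZl_LR /= tri_alt23 mulr0.
  apply: contra tab => /eqP tb0.
  by rewrite (tri_swap23 t b a) tb0 linear0l oppr0.
rewrite dimZ; apply: (@leq_trans (\dim <<[:: t ** a; t ** b]>>)); first by rewrite (eqP freet).
apply: dimvS; apply/span_subvP => v; rewrite !inE => /orP[] /eqP->; exact: saa_pow_mul.
Qed.

Lemma orth_pow_sub i j : (i + j = 9)%N -> (0 < i)%N -> (0 < j)%N -> (pow i <= orth (pow j))%VS.
Proof.
move=> ij i0 j0; apply/subvP => u ui; apply/orthP => v vj.
by rewrite (form0 (i := i) (j := j)) ?ij.
Qed.

Lemma dim_pow_bound i j : (i + j = 9)%N -> (0 < i)%N -> (0 < j)%N ->
  (\dim (pow i) + \dim (pow j) <= 10)%N.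
Proof.
move=> ij i0 j0; have := dimvS (orth_pow_sub ij i0 j0).
by rewrite dim_orth dimL leq_subRL ?(addnC (\dim (pow j))) // -dimL dimvS ?subvf.
Qed.

(** If L^(i+1) = L^i then the series is stationary from there on, and L^7 would
    equal L^8 = 0. *)
Lemma dim_pow_lt i : (0 < i <= 7)%N -> (\dim (pow i.+1) < \dim (pow i))%N.
Proof.
case: i => // i /= le7; rewrite ltn_neqAle dimvS ?saa_powS_sub // andbT.
apply/negP => dimE; apply: pow7.
have stab : pow i.+2 = pow i.+1 by apply/eqP; rewrite eqEdim saa_powS_sub (eqP dimE) /=.
have stabn n : pow (i + n).+1 = pow i.+1.
  elim: n => [|n IH]; first by rewrite addn0.
  by rewrite addnS saa_powS IH -saa_powS.
have := stabn (6 - i)%N; rewrite subnKC // => ->.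
by rewrite -(stabn (7 - i)%N) subnKC ?pow8 // ltnW.
Qed.

(** L^6 lies strictly above L^7, of dimension 2, and inside the orthogonal of
    L^3, which has codimension at most 1 in L^2. *)
Lemma dim_pow_6 : \dim (pow 6) = 3%N.
Proof.
have [a [b gen]] := exists_generates2.
have := dim_pow2 gen; rewrite dim_pow_2 ltnS => le7.
have := @dim_pow_bound 3 6 erefl erefl erefl.
have := @dim_pow_lt 6 erefl; rewrite pow7_center dimZ => ge3 le10.
apply/eqP; rewrite eqn_leq ge3 andbT -(leq_add2l 7).
by apply: leq_trans le10; rewrite leq_add2r.
Qed.

(** The bounds leave the dimensions (6, 4) and (5, 4).  In the second case the
    orthogonal P of L^4 is L^5 extended by one vector s.  Since L^5 is orthogonal
    to P and s to itself, P is isotropic, hence contained in its own orthogonal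
    L^4, and equal to it.  But then L^5 = PL is orthogonal to L^3, so it has
    dimension at most 3. *)
Lemma dim_pow_4_5 : \dim (pow 4) = 6%N /\ \dim (pow 5) = 4%N.
Proof.
have := @dim_pow_lt 5 erefl; rewrite dim_pow_6 => ge4.
have lt54 := @dim_pow_lt 4 erefl.
have le10 := @dim_pow_bound 4 5 erefl erefl erefl.
have dims : (\dim (pow 4) = 6 /\ \dim (pow 5) = 4 \/ \dim (pow 4) = 5 /\ \dim (pow 5) = 4)%N.
  by lia.
case: dims => // -[d4 d5].
set P := orth (pow 4).
have sub5P : (pow 5 <= P)%VS by apply: orth_pow_sub.
have dP : \dim P = 5%N by rewrite dim_orth dimL d4.
have [s sP s5] : exists2 s, s \in P & s \notin pow 5.
  by apply/subvPn; apply/negP => /dimvS; rewrite dP d5.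
have Pdec : P = (<[s]> + pow 5)%VS by apply: vline_addv_codim1; rewrite // dP d5.
have P5 u v : u \in P -> v \in pow 5 -> '(u, v) = 0.
  by move=> /orthP uP v5; apply: uP; apply: (saa_pow_weaken (n := 5)).
have PP : (P <= pow 4)%VS.
  rewrite -(orthK (pow 4)) -/P; apply/subvP => u uP; apply/orthP => v vP.
  move: uP vP; rewrite {1 2}Pdec => uP vP.
  have /memv_addP[_ /vlineP[k ->] [v5 ? ->]] := vP.
  have /memv_addP[_ /vlineP[l ->] [u5 ? ->]] := uP.
  rewrite linearDl !linearDr /= [X in X + _](_ : _ = 0); last first.
    by rewrite !(linearZl_LR, linearZr_LR) /= saa_form_alt P5 // !(mulr0, addr0).
  by rewrite linearZr_LR /= form_skew P5 // (form0 (i := 5) (j := 5)) // oppr0 mulr0 !addr0.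
have P4 : P = pow 4 by apply/eqP; rewrite eqEdim PP d4 dP.
have : (pow 5 <= orth (pow 3))%VS.
  rewrite saa_powS -P4; apply/saa_prodvP => u v /orthP uP _; apply/orthP => w w3.
  by rewrite tri_cyc form_skew uP ?oppr0 // saa_pow_lmul.
have [a [b /dim_pow2]] := exists_generates2.
rewrite dim_pow_2 ltnS => d3 /dimvS; rewrite dim_orth dimL d5.
by move=> /leq_trans/(_ (leq_sub2l 10 d3)).
Qed.

Lemma orth_pow4 : orth (pow 4) = pow 5.
Proof.
have [d4 d5] := dim_pow_4_5.
by apply/esym/eqP; rewrite eqEdim orth_pow_sub // dim_orth dimL d4 d5.
Qed.

Lemma orth_pow3 : orth (pow 3) = pow 6.
Proof.
apply/esym/eqP; rewrite eqEdim orth_pow_sub // dim_orth dimL dim_pow_6 leq_subLR.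
have [a [b /dim_pow2]] := exists_generates2.
by rewrite dim_pow_2 ltnS -(leq_add2r 3).
Qed.

Lemma dim_pow_3 : \dim (pow 3) = 7%N.
Proof. by rewrite -(orthK (pow 3)) orth_pow3 dim_orth dimL dim_pow_6. Qed.

End Class7.

(** * Generators of type y4, y5 and the words in them *)

Lemma form_ext (F : fieldType) (L : saa F) (u v : L) : (forall w, '(u, w) = '(v, w)) -> u = v.
Proof.
move=> uv; apply/eqP; rewrite -subr_eq0; apply/eqP/saa_form_nondeg => w.
by rewrite linearBl /= uv subrr.
Qed.

Ltac expand := rewrite ?(linearDl, linearDr, linearNl, linearNr, linearZl_LR, linearZr_LR) /=.
(** An identity between multilinear expressions in vectors becomes, paired with
    an arbitrary vector, an identity between scalars that [ring] can decide. *)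
Ltac vring :=
  apply: form_ext => ?; do ?progress expand;
  rewrite ?saa_mul_alt ?(linear0r, linear0l) /=; ring.

(** Membership in a power: a product belongs to one power higher than either of
    its factors. *)
Ltac in_pow := solve [
    assumption
  | exact: memvf
  | match goal with H : is_true (?u \in saa_pow _ ?m) |- is_true (?u \in saa_pow _ ?n) =>
      exact: (saa_pow_weaken (n := m) _ H) end
  | apply: memvD; in_pow
  | apply: memvZ; in_pow
  | rewrite memvN; in_pow
  | apply: saa_pow_mul; in_pow
  | apply: saa_pow_lmul; in_pow ].

Section Words.
Variables (F : fieldType) (L : saa F) (a b : L).
(** In the presented algebra, where a = y4 and b = y5, these words are the other
    elements of the standard basis. *)
Definition y3_of : L := b ** a.
Definition y2_of : L := b ** y3_of.
Definition y1_of : L := a ** y2_of.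
Definition x1_of : L := y2_of ** y3_of.
Definition x2_of : L := a ** x1_of.
Definition x3_of : L := b ** x2_of.
Definition x4_of : L := b ** x3_of.
Definition x5_of : L := x3_of ** a.

Lemma y3_pow : y3_of \in saa_pow L 2. Proof. by apply: saa_pow_mul; apply: memvf. Qed.
Lemma y2_pow : y2_of \in saa_pow L 3. Proof. exact: saa_pow_lmul y3_pow. Qed.
Lemma y1_pow : y1_of \in saa_pow L 4. Proof. exact: saa_pow_lmul y2_pow. Qed.
Lemma x1_pow : x1_of \in saa_pow L 4. Proof. exact: saa_pow_mul y2_pow. Qed.
Lemma x2_pow : x2_of \in saa_pow L 5. Proof. exact: saa_pow_lmul x1_pow. Qed.
Lemma x3_pow : x3_of \in saa_pow L 6. Proof. exact: saa_pow_lmul x2_pow. Qed.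
Lemma x4_pow : x4_of \in saa_pow L 7. Proof. exact: saa_pow_lmul x3_pow. Qed.
Lemma x5_pow : x5_of \in saa_pow L 7. Proof. exact: saa_pow_mul x3_pow. Qed.

(** In the presented algebra y4 L^2 <= L^4, and this property determines y4 up
    to scalars modulo L^2, while y5 only has to complete it to a pair of
    generators. *)
Definition adapted := generates2 a b /\ {in saa_pow L 2, forall v, a ** v \in saa_pow L 4}.

End Words.

Section Class7.
Variables (F : fieldType) (L : saa F).
Hypotheses (dimL : \dim (fullv : {vspace L}) = 10%N).
Hypotheses (pow8 : saa_pow L 8 = 0%VS) (pow7 : saa_pow L 7 <> 0%VS).
Hypothesis (dimZ : \dim (saa_center L) = 2%N).
Hypothesis notin_pow4_mul_pow3 : ~~ (saa_pow L 5 *v saa_pow L 2 <= saa_pow L 4 *v saa_pow L 3)%VS.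
Local Notation pow := (saa_pow L).
Local Notation form0 := (form0 pow8).
Local Notation mul0 := (mul0 pow8).

(** Modulo L^3 the power L^2 is spanned by a single element, whose square is 0,
    so that only products of L^2 with L^3 remain. *)
Lemma pow2_mul u v : u \in pow 2 -> v \in pow 2 -> u ** v \in pow 4.
Proof.
have [a [b gen]] := exists_generates2 dimL dimZ.
move=> /(pow2_gen gen)[k [w w3 ->]] /(pow2_gen gen)[l [w' w'3 ->]].
set c := b ** a.
have -> : (k *: c + w) ** (l *: c + w') = k *: (c ** w') + w ** (l *: c + w').
  by vring.
by in_pow.
Qed.

(** L^3 / L^4 is a line, so that a c and b c, where c = ba, are proportional
    modulo L^4: a suitable combination of a and b multiplies c into L^4. *)
Lemma exists_adapted : exists a b : L, adapted a b.
Proof.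
have [d4 _] := dim_pow_4_5 dimL pow8 pow7 dimZ.
have d3 := dim_pow_3 dimL pow8 pow7 dimZ.
have [w w3 w4] : exists2 w, w \in pow 3 & w \notin pow 4.
  by apply/subvPn; apply/negP => /dimvS; rewrite d3 d4.
have dec v : v \in pow 3 -> exists k, exists2 r, r \in pow 4 & v = k *: w + r.
  rewrite (vline_addv_codim1 (saa_powS_sub L 2) _ w3 w4) ?d3 ?d4 //.
  by case/memv_addP => _ /vlineP[k ->] [r r4 ->]; exists k, r.
suff [a [b [gen ac]]] : exists a b, generates2 a b /\ a ** (b ** a) \in pow 4.
  exists a, b; split=> // v /(pow2_gen gen)[k [r r3 ->]].
  rewrite linearDr linearZr_LR; in_pow.
have [a [b gen]] := exists_generates2 dimL dimZ.
have c2 : b ** a \in pow 2 by in_pow.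
have [k [r r4 ack]] : exists k, exists2 r, r \in pow 4 & a ** (b ** a) = k *: w + r.
  by apply: dec; in_pow.
have [l [s s4 bcl]] : exists k, exists2 r, r \in pow 4 & b ** (b ** a) = k *: w + r.
  by apply: dec; in_pow.
have [k0 | kn0] := eqVneq k 0.
  by exists a, b; rewrite ack k0 scale0r add0r.
exists (b - (l / k) *: a), a; split.
  apply/generates2P => v; have [m [n [w' w'2 ->]]] := generates2P _ _ gen v.
  exists n, (m + n * (l / k)), w' => //.
  by vring.
have -> : (b - (l / k) *: a) ** (a ** (b - (l / k) *: a)) =
   (l / k) *: (a ** (b ** a)) - b ** (b ** a).
  by rewrite (mul_skew b a); vring.
have -> : (l / k) *: (a ** (b ** a)) - b ** (b ** a) = (l / k) *: r - s.
  by rewrite ack bcl; apply: form_ext => ?; do ?progress expand; field.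
by in_pow.
Qed.

Section Adapted.
Variables a b : L.
Hypothesis ad : adapted a b.
Local Notation c := (y3_of a b).
Local Notation d := (y2_of a b).
Local Notation e := (y1_of a b).
Local Notation f := (x1_of a b).

Let c2 : c \in pow 2 := y3_pow a b.
Let d3 : d \in pow 3 := y2_pow a b.
Let e4 : e \in pow 4 := y1_pow a b.
Let f4 : f \in pow 4 := x1_pow a b.
Let ac4 : a ** c \in pow 4 := proj2 ad _ c2.

Lemma adapted_pow3 v : v \in pow 3 ->
  exists k, exists2 w, w \in pow 4 & v = k *: d + w.
Proof.
move=> v3.
suff /subvP/(_ v v3)/memv_addP[_ /vlineP[k ->] [w w4 ->]] :
  (pow 3 <= <[d]> + pow 4)%VS by exists k, w.
rewrite saa_powS; apply/saa_prodvP => x y x2 _.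
have [k [w w3 ->]] := pow2_gen (proj1 ad) x2.
have [p [q [r r2 ->]]] := generates2P _ _ (proj1 ad) y.
have cr4 : c ** r \in pow 4 by apply: pow2_mul.
have -> : (k *: (b ** a) + w) ** (p *: a + q *: b + r) =
  (- (k * q)) *: d + ((- (k * p)) *: (a ** c) + k *: (c ** r) + w ** (p *: a + q *: b + r)).
  rewrite /y2_of (mul_skew a c) (mul_skew b c) -/(y3_of a b); vring.
by apply: memv_add; [rewrite memvZ ?memv_line | in_pow].
Qed.

(** L^4 = L^3 L, and modulo L^4 the power L^3 is spanned by y2; the products of
    y2 with a, b and c = y3 are -y1, -(b y2) and x1. *)
Lemma adapted_pow4 v : v \in pow 4 ->
  exists k l m, exists2 w, w \in pow 5 & v = k *: e + l *: (b ** d) + m *: f + w.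
Proof.
move=> v4.
suff /subvP/(_ v v4) : (pow 4 <= <[e]> + <[b ** d]> + <[f]> + pow 5)%VS.
  case/memv_addP => _ /memv_addP[_ /memv_addP[_ /vlineP[k ->] [_ /vlineP[l ->] ->]]
    [_ /vlineP[m ->] ->]] [w w5 ->].
  by exists k, l, m, w.
rewrite saa_powS; apply/saa_prodvP => x y /adapted_pow3[k [w w4 ->]] _.
have [p [q [r r2 ->]]] := generates2P _ _ (proj1 ad) y.
have [n [s s3 ->]] := pow2_gen (proj1 ad) r2.
have [g [h h4 ->]] := adapted_pow3 s3.
have -> : (k *: d + w) ** (p *: a + q *: b + (n *: (b ** a) + (g *: d + h))) =
  (- (k * p)) *: e + (- (k * q)) *: (b ** d) + (k * n) *: f +
  (k *: (d ** h) + w ** (p *: a + q *: b + (n *: (b ** a) + (g *: d + h)))).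
  rewrite /y1_of /x1_of (mul_skew a d) (mul_skew b d) -/(y3_of a b); vring.
by rewrite !memv_add ?memvZ ?memv_line //; in_pow.
Qed.

Lemma pow5_mul_pow2_perp_a u w : u \in pow 5 -> w \in pow 2 -> '(u ** w, a) = 0.
Proof.
move=> u5 w2; rewrite tri_cyc mul_skew linearNl /=.
by rewrite (form0 (i := 4) (j := 5)) ?oppr0 // (proj2 ad).
Qed.

Lemma pow5_mul_perp_pow2 u v w : u \in pow 5 -> v \in pow 2 -> w \in pow 2 -> '(u ** v, w) = 0.
Proof.
by move=> u5 v2 w2; rewrite tri_cyc (form0 (i := 4) (j := 5)) // pow2_mul.
Qed.

(** The orthogonal of L^2 + F a is a line, and it contains L^5 L^2.  A vector v of
    L^4 L^3 on that line would have to be 0, since otherwise L^5 L^2 would be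
    contained in F v, and thus in L^4 L^3. *)
Lemma pow4_mul_pow3_perp_b v : v \in pow 4 *v pow 3 -> '(v, a) = 0 ->
  {in pow 2, forall w, '(v, w) = 0} -> '(v, b) = 0.
Proof.
move=> vV va v2; apply: contraNeq notin_pow4_mul_pow3 => vb.
apply/saa_prodvP => x y x5 y2.
suff -> : x ** y = ('(x ** y, b) / '(v, b)) *: v by apply: memvZ.
apply: form_ext => u.
have [k [l [w w2 ->]]] := generates2P _ _ (proj1 ad) u.
have := pow5_mul_pow2_perp_a x5 y2; have := pow5_mul_perp_pow2 x5 y2 w2.
move: (x ** y) => z zw za; do ?progress expand.
by rewrite za zw va (v2 w w2) !(mulr0, add0r, addr0) mulrCA divfK.
Qed.

Lemma pow4_mul_y2_perp_b u : u \in pow 4 ->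
  '(u ** d, a) = 0 -> '(u ** d, c) = 0 -> '(u ** d, b) = 0.
Proof.
move=> u4 ua uc; apply: pow4_mul_pow3_perp_b => //; first exact: saa_memv_mul.
move=> w /(pow2_gen (proj1 ad))[k [r /adapted_pow3[l [s s4 ->]] ->]].
do ?progress expand; rewrite uc tri_alt23 tri_swap23 (tri0 pow8 (i := 4) (j := 4)) //.
by rewrite oppr0 !(mulr0, addr0).
Qed.

Lemma pow4_isotropic_absurd : ~ {in pow 4 &, forall u v, '(u, v) = 0}.
Proof.
move=> iso; have [d4 d5] := dim_pow_4_5 dimL pow8 pow7 dimZ.
have : (pow 4 <= orth (pow 4))%VS by apply/subvP => u u4; apply/orthP => v v4; apply: iso.
by move/dimvS; rewrite orth_pow4 // d4 d5.
Qed.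

(** Suppose that (x1,y1) = 0.  The vectors x1 y2 and y1 y2 of L^4 L^3 are then
    orthogonal to L^2 and to a, hence to b as well.  By cyclicity this says that
    b y2 is orthogonal to x1 and y1, so that the three vectors y1, b y2, x1,
    which span L^4 modulo L^5, are pairwise orthogonal, and L^4 is isotropic. *)
Lemma x1_y1_neq0 : '(f, e) != 0.
Proof.
apply/eqP => fe0; have ef0 : '(e, f) = 0 by rewrite form_skew fe0 oppr0.
have bdf : '(b ** d, f) = 0.
  apply/eqP; rewrite -oppr_eq0 -linearNl /= -mul_skew -tri_cyc; apply/eqP.
  apply: pow4_mul_y2_perp_b => //; first by rewrite tri_cyc mul_skew linearNl /= ef0 oppr0.
  by rewrite tri_cyc saa_form_alt.
have bde : '(b ** d, e) = 0.
  apply/eqP; rewrite -oppr_eq0 -linearNl /= -mul_skew -tri_cyc; apply/eqP.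
  apply: pow4_mul_y2_perp_b => //; first by rewrite tri_cyc mul_skew linearNl /= saa_form_alt oppr0.
  by rewrite tri_cyc fe0.
have ebd : '(e, b ** d) = 0 by rewrite form_skew bde oppr0.
have fbd : '(f, b ** d) = 0 by rewrite form_skew bdf oppr0.
apply: pow4_isotropic_absurd => u v.
move=> /adapted_pow4[k [l [m [w w5 ->]]]] /adapted_pow4[k' [l' [m' [w' w'5 ->]]]].
have bd4 : b ** d \in pow 4 by in_pow.
have z4 x : x \in pow 4 -> '(x, w') = 0 by move=> x4; apply: (form0 (i := 4) (j := 5)).
have z5 x : x \in pow 4 -> '(w, x) = 0 by move=> x4; apply: (form0 (i := 5) (j := 4)).
do ?progress expand.
rewrite !saa_form_alt fe0 ef0 bdf bde ebd fbd !z4 ?z5 ?(saa_pow_weaken _ w5) //.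
by rewrite !(mulr0, addr0).
Qed.

Lemma pow5P u : u \in pow 4 -> '(u, e) = 0 -> '(u, b ** d) = 0 -> '(u, f) = 0 -> u \in pow 5.
Proof.
move=> u4 ue ubd uf; rewrite -(orth_pow4 dimL pow8 pow7 dimZ); apply/orthP => v.
move=> /adapted_pow4[k [l [m [w w5 ->]]]]; do ?progress expand.
by rewrite ue ubd uf (form0 (i := 4) (j := 5)) // !(mulr0, addr0).
Qed.

Lemma adapted_change l u w : u \in pow 2 -> w \in pow 2 -> adapted (a + u) (b + l *: a + w).
Proof.
move=> u2 w2; split=> [|v v2].
  apply/generates2P => v; have [p [q [r r2 ->]]] := generates2P _ _ (proj1 ad) v.
  exists (p - l * q), q, (r - (p - l * q) *: u - q *: w); first by in_pow.
  by vring.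
by rewrite linearDl /= memvD ?(proj2 ad) ?pow2_mul.
Qed.

Lemma form45 u v : u \in pow 4 -> v \in pow 5 -> '(u, v) = 0.
Proof. exact: (form0 (i := 4) (j := 5)). Qed.

Lemma form54 u v : u \in pow 5 -> v \in pow 4 -> '(u, v) = 0.
Proof. exact: (form0 (i := 5) (j := 4)). Qed.

(** On L^4 the form only sees classes modulo L^5.  All values needed to normalise
    the generators are of this kind, so it suffices to compute modulo L^5. *)
Lemma form_mod_pow5 u v u' v' : u \in pow 4 -> v \in pow 4 -> u' \in pow 5 -> v' \in pow 5 ->
  '(u + u', v + v') = '(u, v).
Proof.
move=> u4 v4 u5 v5; do ?progress expand.
by rewrite (form45 u4 v5) (form54 u5 v4) (form54 u5 (@saa_pow_weaken _ _ 4 5 _ isT v5)) !addr0.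
Qed.

End Adapted.

(** * Normalising the generators *)

Section Normalise.
Variables a b : L.
Hypothesis ad : adapted a b.
Local Notation c := (y3_of a b).
Local Notation d := (y2_of a b).
Local Notation e := (y1_of a b).
Local Notation f := (x1_of a b).

Let c2 : c \in pow 2 := y3_pow a b.
Let d3 : d \in pow 3 := y2_pow a b.
Let e4 : e \in pow 4 := y1_pow a b.
Let f4 : f \in pow 4 := x1_pow a b.
Let ac4 : a ** c \in pow 4 := proj2 ad _ c2.

(** Replace b by b' = b + l a + k y3.  Modulo L^5 the words y1, x1 are unchanged
    and b y2 becomes b y2 + l y1 - k x1.  So its products with x1 and y1 are
    lowered by l (x1,y1) and k (x1,y1) respectively. *)
Lemma clear_b_y2 : exists b', adapted a b' /\ b' ** y2_of a b' \in pow 5.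
Proof.
pose l := '(b ** d, f) / '(f, e); pose k := '(b ** d, e) / '(f, e).
exists (b + l *: a + k *: c); set b' := _ + _.
have ad' : adapted a b'.
  by have := adapted_change ad l (mem0v _) (memvZ k c2); rewrite addr0.
split=> //.
pose r := k *: (c ** a).
have r4 : r \in pow 4 by rewrite memvZ // mul_skew memvN.
have c'E : y3_of a b' = c + r by rewrite /y3_of; vring.
pose s := l *: (a ** c) + b' ** r.
have s4 : s \in pow 4 by in_pow.
have d'E : y2_of a b' = d + s by rewrite {1}/y2_of c'E /s /b' /y2_of; vring.
have e'E : y1_of a b' = e + a ** s by rewrite {1}/y1_of d'E /y1_of; vring.
have f'E : x1_of a b' = f + (s ** (c + r) + d ** r).
  by rewrite {1}/x1_of d'E c'E /x1_of; vring.
(* modulo L^5 this is b y2 + l y1 - k x1, as y3 y2 = - x1 *)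
have b'dE : b' ** y2_of a b' = b ** d + l *: e - k *: f + b' ** s.
  by rewrite d'E /b' /y1_of /x1_of (mul_skew d c); vring.
have bd4 : b ** d \in pow 4 by in_pow.
apply: (pow5P ad').
- by apply: saa_pow_lmul; apply: y2_pow.
- rewrite b'dE e'E form_mod_pow5 //; try in_pow.
  do ?progress expand; rewrite saa_form_alt /k.
  by rewrite divfK ?(x1_y1_neq0 ad) // mulr0 addr0 subrr.
- by rewrite saa_form_alt.
- rewrite b'dE f'E form_mod_pow5 //; try in_pow.
  do ?progress expand; rewrite saa_form_alt (form_skew e) /l.
  by rewrite mulrN divfK ?(x1_y1_neq0 ad) // mulr0 subrr oppr0 addr0.
Qed.

Hypothesis bd5 : b ** d \in pow 5.

(** Replace a by a' = a + k y3 + l y2.  Modulo L^5 the word x1 is unchanged, y1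
    becomes y1 - k x1, and a y3 becomes a y3 + k y1 + (l - k^2) x1.  Its product
    with x1 is lowered by k (x1,y1), which determines k; the product with y1
    then involves l with coefficient (x1,y1). *)
Lemma clear_a_y3 : exists a',
  [/\ adapted a' b, b ** y2_of a' b \in pow 5 & a' ** y3_of a' b \in pow 5].
Proof.
pose k := '(a ** c, f) / '(f, e).
pose l := (k * '(a ** c, f) - '(a ** c, e)) / '(f, e).
have u2 : k *: c + l *: d \in pow 2 by in_pow.
exists (a + (k *: c + l *: d)); set a' := _ + _.
have ad' : adapted a' b.
  by have := adapted_change ad 0 u2 (mem0v _); rewrite scale0r !addr0.
pose r := l *: (b ** d).
have r5 : r \in pow 5 by in_pow.
have c'E : y3_of a' b = c + k *: d + r by rewrite {1}/y3_of /a' /r /y3_of /y2_of /y3_of; vring.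
pose s := k *: (b ** d) + b ** r.
have s5 : s \in pow 5 by in_pow.
have d'E : y2_of a' b = d + s by rewrite {1}/y2_of c'E /s {1}/y2_of; vring.
have e'E : y1_of a' b = (e - k *: f) + a' ** s.
  by rewrite {1}/y1_of d'E /a' /y1_of /x1_of (mul_skew d c); vring.
have f'E : x1_of a' b = f + (s ** y3_of a' b + d ** r).
  by rewrite {1}/x1_of d'E c'E /x1_of; vring.
have a'cE : a' ** y3_of a' b = (a ** c + k *: e + (l - k ^+ 2) *: f) + a' ** r.
  rewrite c'E /a' /y1_of /x1_of; apply: form_ext => w; do ?progress expand.
  by rewrite (tri_swap12 d c w) !saa_mul_alt linear0l; ring.
have bd5' : b ** y2_of a' b \in pow 5 by rewrite d'E linearDr; in_pow.
split=> //; apply: (pow5P ad').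
- by apply: (proj2 ad'); apply: y3_pow.
- rewrite a'cE e'E form_mod_pow5 //; try in_pow.
  do ?progress expand; rewrite !saa_form_alt (form_skew e) /l.
  by rewrite /k; field; apply: (x1_y1_neq0 ad).
- by apply: form45; rewrite // (proj2 ad') ?y3_pow.
- rewrite a'cE f'E form_mod_pow5 //; try in_pow.
  do ?progress expand; rewrite saa_form_alt (form_skew e).
  by rewrite /k; field; apply: (x1_y1_neq0 ad).
Qed.

Hypothesis ac5 : a ** c \in pow 5.

Lemma x5_b_form : '(x5_of a b, b) = '(f, e).
Proof.
rewrite /x5_of tri_cyc mul_skew linearNl /= -/(y3_of a b) form_skew opprK.
rewrite -/(y3_of a b) /x3_of -tri_cyc mul_skew linearNl /= -/(y2_of a b).
rewrite -form_skew /x2_of -tri_cyc mul_skew linearNl /= -/(y1_of a b).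
by rewrite -form_skew.
Qed.

(** Replace a by a' = a + k y1 + h x5.  This changes neither y2 modulo L^6 nor
    the fact that b y2 and a y3 lie in L^5; (a y3, y2) is lowered by k (x1,y1),
    and the central summand h x5 only influences (a,b). *)
Lemma clear_remaining : exists a',
  [/\ adapted a' b, b ** y2_of a' b \in pow 5, a' ** y3_of a' b \in pow 5,
     '(a' ** y3_of a' b, y2_of a' b) = 0 & '(a', b) = 0].
Proof.
pose k := '(a ** c, d) / '(f, e).
pose h := - '(a + k *: e, b) / '(x5_of a b, b).
have x57 : x5_of a b \in pow 7 by apply: x5_pow.
have u2 : k *: e + h *: x5_of a b \in pow 2 by in_pow.
exists (a + (k *: e + h *: x5_of a b)); set a' := _ + _.
have ad' : adapted a' b.
  by have := adapted_change ad 0 u2 (mem0v _); rewrite scale0r !addr0.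
pose r := k *: (b ** e) + h *: (b ** x5_of a b).
have r5 : r \in pow 5 by in_pow.
have c'E : y3_of a' b = c + r by rewrite {1}/y3_of /a' /r {1}/y3_of; vring.
have d'E : y2_of a' b = d + b ** r by rewrite {1}/y2_of c'E; vring.
have a'cE : a' ** y3_of a' b = a ** c + k *: (e ** c) + a' ** r.
  rewrite c'E /a'.
  have x5c : x5_of a b ** c = 0 by apply: (mul0 (i := 7) (j := 2)).
  transitivity (a ** c + k *: (e ** c) + h *: (x5_of a b ** c) + a' ** r).
    by rewrite /a'; vring.
  by rewrite x5c scaler0 addr0.
split=> //.
- by rewrite d'E linearDr; in_pow.
- by rewrite a'cE; in_pow.
- rewrite a'cE d'E linearDr /= [X in _ + X](form0 (i := 4) (j := 6)) ?addr0 //; try in_pow.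
  rewrite linearDl /= [X in _ + X](form0 (i := 6) (j := 3)) ?addr0 //; try in_pow.
  do ?progress expand.
  rewrite (tri_cyc e c d) (mul_skew c d) linearNl /= -/(x1_of a b).
  by rewrite /k; field; apply: (x1_y1_neq0 ad).
- rewrite /a' addrA linearDl linearZl_LR /= /h divfK ?addrN //.
  by rewrite x5_b_form (x1_y1_neq0 ad).
Qed.

End Normalise.

(** The scaling (a,b) -> (n a, b / n) fixes y3 and y1 and divides y2 and x1
    by n. *)
Lemma exists_normal_generators : exists a b,
  [/\ adapted a b, '(x1_of a b, y1_of a b) = 1,
   b ** y2_of a b \in pow 5, a ** y3_of a b \in pow 5 &
     '(a ** y3_of a b, y2_of a b) = 0 /\ '(a, b) = 0].
Proof.
have [a0 [b0 ad0]] := exists_adapted.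
have [b [ad bd5]] := clear_b_y2 ad0.
have [a1 [ad1 bd51 ac51]] := clear_a_y3 ad bd5.
have [a [{bd5}ad' bd5 ac5 acd ab]] := clear_remaining ad1 bd51 ac51.
have := x1_y1_neq0 ad'; set n := '(_, _) => n0.
exists (n *: a), (n^-1 *: b).
have cE : y3_of (n *: a) (n^-1 *: b) = y3_of a b.
  by rewrite /y3_of linearZl_LR linearZr_LR /= scalerA mulVf ?scale1r.
have dE : y2_of (n *: a) (n^-1 *: b) = n^-1 *: y2_of a b.
  by rewrite /y2_of cE linearZl_LR.
have eE : y1_of (n *: a) (n^-1 *: b) = y1_of a b.
  by rewrite /y1_of dE linearZl_LR linearZr_LR /= scalerA mulfV ?scale1r.
have fE : x1_of (n *: a) (n^-1 *: b) = n^-1 *: x1_of a b.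
  by rewrite /x1_of dE cE linearZl_LR.
split; rewrite ?eE ?fE ?dE ?cE.
- split=> [|v v2]; last by rewrite linearZl_LR memvZ // (proj2 ad').
  apply/generates2P => v; have [k [l [w w2 ->]]] := generates2P _ _ (proj1 ad') v.
  exists (k / n), (l * n), w => //.
  by apply: form_ext => ?; do ?progress expand; field.
- by rewrite linearZl_LR /= -/n mulVf.
- by rewrite linearZl_LR linearZr_LR /= !memvZ.
- by rewrite linearZl_LR memvZ.
by split; rewrite linearZl_LR ?linearZr_LR /= ?linearZl_LR /= ?acd ?ab !mulr0.
Qed.

End Class7.

(** * Standard bases and isomorphisms *)

Definition sb_dual n (i : sb_index n) : sb_index n :=
  match i with inl j => inr j | inr j => inl j end.

Definition sb_sign (F : fieldType) n (i : sb_index n) : F :=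
  match i with inl _ => 1 | inr _ => -1 end.

Lemma sb_dualK n : involutive (@sb_dual n).
Proof. by case. Qed.

Lemma sb_sign_sq (F : fieldType) n (i : sb_index n) : sb_sign F i * sb_sign F i = 1.
Proof. by case: i => i; rewrite /= ?mulrNN mulr1. Qed.

Section StandardBasis.
Variables (F : fieldType) (L : saa F) (n : nat) (b : sb_index n -> L).
Local Notation sgn := (sb_sign F).

(** The three families of relations of a standard basis in a single formula: up
    to sign, [sb_dual] is passage to the dual basis. *)
Definition symplectic_family :=
  forall i j, '(b i, b (sb_dual j)) = sgn i * (i == j)%:R.

Lemma symplectic_familyP :
  [/\ forall i j, '(b (inl i), b (inl j)) = 0,
      forall i j, '(b (inr i), b (inr j)) = 0
    & forall i j, '(b (inl i), b (inr j)) = (i == j)%:R] <-> symplectic_family.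
Proof.
split=> [[xx yy xy] [i|i] [j|j] | sf]; rewrite /= ?xx ?yy ?xy.
- by rewrite mul1r.
- by rewrite mulr0.
- by rewrite mulr0.
- by rewrite form_skew xy mulN1r eq_sym.
split=> i j.
- by rewrite (sf _ (inr j)) mulr0.
- by rewrite (sf _ (inl j)) mulr0.
by rewrite (sf _ (inl j)) mul1r.
Qed.

Lemma symplectic_family_basis : symplectic_family ->
  \dim (fullv : {vspace L}) = (n + n)%N -> basis_of fullv (codom b).
Proof.
move=> sf dimL; rewrite basisEfree subvf size_codom card_sum card_ord dimL leqnn !andbT /=.
apply/freeP => k k0 i.
have := congr1 (fun v => '(v, b (sb_dual (enum_val i)))) k0.
rewrite linear0l linear_sumlz (bigD1 i) //= big1 => [|j ji].
  rewrite linearZl_LR /= (nth_map (enum_val i)) -?cardE // -enum_val_nth sf eqxx mulr1 addr0.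
  by case: (enum_val i) => ? /=; rewrite ?mulr1 // mulrN1 => /eqP; rewrite oppr_eq0 => /eqP.
rewrite linearZl_LR /= (nth_map (enum_val i)) -?cardE // -enum_val_nth sf.
by rewrite (inj_eq enum_val_inj) (negPf ji) !mulr0.
Qed.

Hypothesis sb : standard_basis b.

Lemma standard_basis_form : symplectic_family.
Proof. by apply/symplectic_familyP; case: sb. Qed.

Lemma standard_basis_ind (P : L -> Prop) :
  P 0 -> (forall k u v, P u -> P v -> P (k *: u + v)) -> (forall i, P (b i)) ->
  forall v, P v.
Proof.
move=> P0 PD Pb v; have [+ _ _ _] := sb => /andP[/eqP span_b _].
have := memvf v; rewrite -span_b => /coord_span ->.
elim/big_rec: _ => // i w _ Pw; apply: PD => //.
by have /codomP[j ->] : (codom_tuple b)`_i \in codom b by rewrite mem_nth ?size_tuple.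
Qed.

Lemma standard_basis_coord v : v = \sum_i (sgn i * '(v, b (sb_dual i))) *: b i.
Proof.
elim/standard_basis_ind: v => [|k u v Hu Hv|j].
- by rewrite big1 // => i _; rewrite linear0l mulr0 scale0r.
- rewrite {1}Hu {1}Hv scaler_sumr -big_split /=; apply: eq_bigr => i _.
  by rewrite linearDl linearZl_LR /= scalerA -scalerDl mulrDr mulrCA.
rewrite (bigD1 j) //= standard_basis_form eqxx mulr1 sb_sign_sq scale1r big1 ?addr0 // => i ij.
by rewrite standard_basis_form eq_sym (negPf ij) !mulr0 scale0r.
Qed.

End StandardBasis.

Section Isomorphism.
Variables (F : fieldType) (L M : saa F) (n : nat).
Variables (b : sb_index n -> L) (b' : sb_index n -> M).
Hypotheses (sb : standard_basis b) (sb' : standard_basis b').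

Definition basis_map (v : L) : M := \sum_i (sb_sign F i * '(v, b (sb_dual i))) *: b' i.

Lemma basis_map_linear : linear basis_map.
Proof.
move=> k u v; rewrite /basis_map scaler_sumr -big_split /=; apply: eq_bigr => i _.
by rewrite linearPl /= scalerA -scalerDl mulrDr mulrCA.
Qed.

HB.instance Definition _ := GRing.isLinear.Build F L M _ basis_map basis_map_linear.

Lemma basis_map_basis j : basis_map (b j) = b' j.
Proof.
rewrite /basis_map (bigD1 j) //= (standard_basis_form sb) eqxx mulr1 sb_sign_sq scale1r.
rewrite big1 ?addr0 // => i ij.
by rewrite (standard_basis_form sb) eq_sym (negPf ij) !mulr0 scale0r.
Qed.

Lemma basis_map_form u v : '(basis_map u, basis_map v) = '(u, v).
Proof.
elim/(standard_basis_ind sb): u v => [v|k u1 u2 H1 H2 v|i].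
- by rewrite linear0 !linear0l.
- by rewrite linearP !linearPl H1 H2.
elim/(standard_basis_ind sb) => [|k v1 v2 H1 H2|j].
- by rewrite linear0 !linear0r.
- by rewrite linearP !linearPr H1 H2.
by rewrite !basis_map_basis -(sb_dualK j) !standard_basis_form.
Qed.

End Isomorphism.

Lemma basis_mapK (F : fieldType) (L M : saa F) n (b : sb_index n -> L) (b' : sb_index n -> M) :
  standard_basis b -> standard_basis b' -> cancel (basis_map b b') (basis_map b' b).
Proof.
move=> sb sb'; elim/(standard_basis_ind sb) => [|k u v Hu Hv|i].
- by rewrite !linear0.
- by rewrite !linearP /= Hu Hv.
by rewrite !basis_map_basis.
Qed.

Section SameTensor.
Variables (F : fieldType) (L M : saa F) (n : nat).
Variables (b : sb_index n -> L) (b' : sb_index n -> M).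
Hypotheses (sb : standard_basis b) (sb' : standard_basis b').
Hypothesis same : forall i j k, '(b i ** b j, b k) = '(b' i ** b' j, b' k).

(** Trilinearity reduces the claim to basis vectors, one argument at a time. *)
Lemma basis_map_tri u v w :
  '(basis_map b b' u ** basis_map b b' v, basis_map b b' w) = '(u ** v, w).
Proof.
elim/(standard_basis_ind sb): u v w => [v w|k u1 u2 H1 H2 v w|i].
- by rewrite linear0 !linear0l.
- by rewrite linearP !linearPl /= H1 H2.
elim/(standard_basis_ind sb) => [w|k v1 v2 H1 H2 w|j].
- by rewrite linear0 !linear0r !linear0l.
- by rewrite linearP !linearPr !linearPl /= H1 H2.
elim/(standard_basis_ind sb) => [|k w1 w2 H1 H2|k].
- by rewrite linear0 !linear0r.
- by rewrite linearP !linearPr H1 H2.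
by rewrite !basis_map_basis.
Qed.

(** The product is determined by T and the form, both of which [basis_map]
    preserves. *)
Lemma same_tensor_isomorphic : saa_isomorphic L M.
Proof.
exists (basis_map b b'); split.
- by exists (basis_map b' b); apply: basis_mapK.
- move=> u v; apply: form_ext => w.
  rewrite -(basis_mapK sb' sb w) basis_map_tri.
  by rewrite basis_map_form.
exact: basis_map_form.
Qed.

End SameTensor.

Lemma perm_eq_pair (T : eqType) (j k j' k' : T) : perm_eq [:: j; k] [:: j'; k'] ->
  j = j' /\ k = k' \/ j = k' /\ k = j'.
Proof.
move=> jk; have : j \in [:: j'; k'] by rewrite -(perm_mem jk) mem_head.
rewrite !inE => /orP[] /eqP jE; move: jk; rewrite {}jE => jk; [left | right]; move: jk.
  by rewrite perm_cons => kk; case: (@perm_small_eq _ _ [:: k'] isT kk).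
rewrite (permPr (permEl (perm_catC [:: j'] [:: k']))) perm_cons => kj.
by case: (@perm_small_eq _ _ [:: j'] isT kj).
Qed.

(** Adjacent transpositions generate the permutations of three letters. *)
Lemma perm_eq_triple (T : eqType) (i j k i' j' k' : T) (Q : T -> T -> T -> Prop) :
  perm_eq [:: i; j; k] [:: i'; j'; k'] ->
  Q i' j' k' -> (forall x y z, Q x y z -> Q y x z) -> (forall x y z, Q x y z -> Q x z y) ->
  Q i j k.
Proof.
move=> ijk Q0 Q12 Q23; have : i \in [:: i'; j'; k'] by rewrite -(perm_mem ijk) mem_head.
rewrite !inE => /or3P[] /eqP iE; move: ijk; rewrite {}iE.
- by rewrite perm_cons => /perm_eq_pair[] [-> ->]; auto.
- rewrite (permPr (permEl (perm_catCA [:: i'] [:: j'] [:: k']))) perm_cons.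
  by move=> /perm_eq_pair[] [-> ->]; auto.
rewrite (permPr (permEl (perm_catC [:: i'; j'] [:: k']))) perm_cons.
by move=> /perm_eq_pair[] [-> ->]; auto.
Qed.

(** The scalar s is the sign of a permutation, and the point is that it depends on
    the indices only, not on the algebra. *)
Lemma tri_perm (F : fieldType) (I : eqType) (i j k i' j' k' : I) :
  perm_eq [:: i; j; k] [:: i'; j'; k'] ->
  exists s : F, forall (L : saa F) (b : I -> L),
    '(b i ** b j, b k) = s * '(b i' ** b j', b k').
Proof.
move=> ijk; pattern i, j, k; apply: perm_eq_triple ijk _ _ _.
- by exists 1 => L b; rewrite mul1r.
- by move=> x y z [s sE]; exists (- s) => L b; rewrite tri_swap12 sE mulNr.
- by move=> x y z [s sE]; exists (- s) => L b; rewrite tri_swap23 sE mulNr.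
Qed.

Lemma presented_isomorphic (F : fieldType) n (P : presentation F n) (L M : saa F) :
  saa_presented_by P L -> saa_presented_by P M -> saa_isomorphic L M.
Proof.
move=> [b [sb bP b0]] [b' [sb' b'P b'0]]; apply: (same_tensor_isomorphic sb sb') => i j k.
pose listed (r : sb_index n * sb_index n * sb_index n * F) :=
  perm_eq [:: i; j; k] [:: r.1.1.1; r.1.1.2; r.1.2].
have [/hasP[[[[i' j'] k'] c] rP ijk] | /hasPn nP] := boolP (has listed P).
  have [s sE] := tri_perm F ijk.
  by rewrite !sE (bP _ _ _ _ rP) (b'P _ _ _ _ rP).
by rewrite b0 ?b'0 // => i' j' k' c /nP.
Qed.

(** * The algebra built from a presentation *)

Section Model.
Variables (F : fieldType) (n : nat) (P : presentation F n).
Local Notation V := {ffun sb_index n -> F^o}.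
Implicit Types (u v w : V) (i j k : sb_index n).

Definition model_form u v : F :=
  \sum_(i < n) (u (inl i) * v (inr i) - u (inr i) * v (inl i)).

(** The minor of the coordinate matrix of u, v, w in the columns i, j, k. *)
Definition det3 i j k u v w : F :=
  u i * (v j * w k - v k * w j) - u j * (v i * w k - v k * w i)
  + u k * (v i * w j - v j * w i).

Definition model_tri u v w : F :=
  \sum_(r <- P) r.2 * det3 r.1.1.1 r.1.1.2 r.1.2 u v w.

Definition std_vec i : V := [ffun j => (j == i)%:R].

(** The vector uv with (uv, w) = T(u,v,w) for all w, written in dual bases. *)
Definition model_mul u v : V :=
  [ffun i => match i with
             | inl j => model_tri u v (std_vec (inr j))
             | inr j => - model_tri u v (std_vec (inl j))
             end].

Lemma model_form_bilinear : bilinear_for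
  (GRing.Scale.Law.clone _ _ *%R _) (GRing.Scale.Law.clone _ _ *%R _) model_form.
Proof.
split=> [v|u] a x y /=; rewrite /model_form mulr_sumr -big_split /=;
  by apply: eq_bigr => i _; rewrite !ffunE /GRing.scale /=; ring.
Qed.

HB.instance Definition _ := bilinear_isBilinear.Build F V V F _ _ model_form model_form_bilinear.

Lemma model_tri_linearl a x y v w :
  model_tri (a *: x + y) v w = a * model_tri x v w + model_tri y v w.
Proof.
rewrite /model_tri mulr_sumr -big_split /=; apply: eq_bigr => r _.
by rewrite /det3 !ffunE /GRing.scale /=; ring.
Qed.

Lemma model_tri_cyc u v w : model_tri u v w = model_tri v w u.
Proof. by apply: eq_bigr => r _; rewrite /det3; ring. Qed.

Lemma model_tri_alt u w : model_tri u u w = 0.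
Proof. by rewrite /model_tri big1 // => r _; rewrite /det3; ring. Qed.

Lemma model_mul_bilinear : bilinear_for
  (GRing.Scale.Law.clone _ _ *:%R _) (GRing.Scale.Law.clone _ _ *:%R _) model_mul.
Proof.
have tri_linear2 a x y u w :
    model_tri u (a *: x + y) w = a * model_tri u x w + model_tri u y w.
  by rewrite !(model_tri_cyc u) model_tri_linearl.
split=> [v|u] a x y; apply/ffunP => -[i|i];
  by rewrite !ffunE ?model_tri_linearl ?tri_linear2 /GRing.scale //=; ring.
Qed.

HB.instance Definition _ := bilinear_isBilinear.Build F V V V _ _ model_mul model_mul_bilinear.

Lemma model_form_alt u : model_form u u = 0.
Proof. by rewrite /model_form big1 // => i _; rewrite mulrC subrr. Qed.

Lemma model_form_std u i : model_form u (std_vec (sb_dual i)) = sb_sign F i * u i.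
Proof.
rewrite /model_form; case: i => i; rewrite (bigD1 i) //= !ffunE eqxx big1 ?addr0.
all: try by move=> j ji; rewrite !ffunE /eq_op /= (negPf ji) !mulr0 subr0.
all: by rewrite !(mulr0, mulr1, subr0, sub0r) ?mul1r ?mulN1r.
Qed.

Lemma model_form_nondeg u : (forall v, model_form u v = 0) -> u = 0.
Proof.
move=> u0; apply/ffunP => i; have := model_form_std u i.
rewrite u0 ffunE; case: i => i /=; rewrite ?mul1r ?mulN1r => /esym // /eqP.
by rewrite oppr_eq0 => /eqP.
Qed.

Lemma vec_std w : w = \sum_i w i *: std_vec i.
Proof.
apply/ffunP => j; rewrite sum_ffunE (bigD1 j) //= !ffunE eqxx big1 => [|i ij].
  by rewrite addr0 /GRing.scale /= mulr1.
by rewrite !ffunE eq_sym (negPf ij) /GRing.scale /= mulr0.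
Qed.

Lemma model_mul_form u v w : model_form (model_mul u v) w = model_tri u v w.
Proof.
rewrite [in RHS](vec_std w) [RHS](_ : _ = \sum_i w i * model_tri u v (std_vec i)).
  rewrite big_sumType /= -big_split; apply: eq_bigr => i _ /=.
  by rewrite !ffunE mulNr opprK addrC mulrC; congr (_ + _); rewrite mulrC.
rewrite model_tri_cyc model_tri_cyc.
apply: (big_ind2 (fun x y => model_tri x u v = y)) => [|x x' y y' <- <-|i _].
- by rewrite /model_tri big1 // => r _; rewrite /det3 !ffunE; ring.
- by have := model_tri_linearl 1 x y u v; rewrite scale1r mul1r.
rewrite -[_ *: _]addr0 model_tri_linearl [X in _ + X](_ : _ = 0) ?addr0.
  by rewrite -model_tri_cyc -model_tri_cyc.
by rewrite /model_tri big1 // => r _; rewrite /det3 !ffunE; ring.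
Qed.

Lemma model_mul_alt u : model_mul u u = 0.
Proof. by apply/ffunP => -[i|i]; rewrite !ffunE model_tri_alt ?oppr0. Qed.

Lemma model_mul_cyc u v w : model_form (model_mul u v) w = model_form (model_mul v w) u.
Proof. by rewrite !model_mul_form model_tri_cyc. Qed.

Definition model : saa F :=
  Saa (saa_sort := V) (saa_form := model_form) (saa_mul := model_mul)
    model_form_alt model_form_nondeg model_mul_alt model_mul_cyc.

Lemma dim_model : \dim (fullv : {vspace model}) = (n + n)%N.
Proof.
by rewrite dimvf [dim _](_ : _ = #|sb_index n| * 1)%N // muln1 card_sum card_ord.
Qed.

Lemma std_vec_form (i j : sb_index n) :
  saa_form model (std_vec i) (std_vec (sb_dual j)) = sb_sign F i * (i == j)%:R.
Proof.
rewrite [LHS]model_form_std ffunE eq_sym.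
by have [-> // | _] := eqVneq i j; rewrite !mulr0.
Qed.

Lemma std_vec_basis : standard_basis (std_vec : _ -> model).
Proof.
have sf : symplectic_family (std_vec : _ -> model) := std_vec_form.
have [xx yy xy] := (symplectic_familyP _).2 sf.
by split=> //; apply: symplectic_family_basis => //; apply: dim_model.
Qed.

Lemma std_vec_tri i j k : saa_form model (saa_mul model (std_vec i) (std_vec j)) (std_vec k)
   = model_tri (std_vec i) (std_vec j) (std_vec k).
Proof. exact: model_mul_form. Qed.

(** The minor is an alternating sum of six products of Kronecker symbols, and a
    nonzero product exhibits i, j, k as a permutation of the listed triple. *)
Lemma model_tri_unlisted i j k :
  (forall i' j' k' c, (i', j', k', c) \in P -> ~~ perm_eq [:: i; j; k] [:: i'; j'; k']) ->
  model_tri (std_vec i) (std_vec j) (std_vec k) = 0.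
Proof.
move=> nP; rewrite /model_tri big_seq big1 // => -[[[i' j'] k'] c] /nP /=.
apply: contraNeq => det_neq0.
pose D x y z := std_vec i x * std_vec j y * std_vec k z.
have D0 x y z : D x y z != 0 -> perm_eq [:: i; j; k] [:: x; y; z].
  rewrite /D !ffunE.
  have [->|_] := eqVneq x i; last by rewrite !mul0r eqxx.
  have [->|_] := eqVneq y j; last by rewrite mulr0 mul0r eqxx.
  by have [->|_] := eqVneq z k; last by rewrite mulr0 eqxx.
apply: contraR det_neq0 => nperm.
have D0' x y z : perm_eq [:: i'; j'; k'] [:: x; y; z] -> D x y z = 0.
  move=> xyz; apply: contraNeq nperm => /D0 /permPl ->.
  by rewrite perm_sym.
rewrite [det3 _ _ _ _ _ _](_ : _ = D i' j' k' - D i' k' j' - D j' i' k' + D k' i' j'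
  + D j' k' i' - D k' j' i'); last by rewrite /det3 /D; ring.
by rewrite !D0' ?subr0 ?addr0 ?mulr0 ?eqxx //; apply/permP => p /=; lia.
Qed.

End Model.

Lemma model_P10 (F : fieldType) : saa_presented_by (P10_2_7 F) (model (P10_2_7 F)).
Proof.
exists (@std_vec F 5); split.
- exact: std_vec_basis.
- move=> i j k c; rewrite std_vec_tri !inE => /or4P[] /eqP[-> -> -> ->];
    by rewrite /model_tri /P10_2_7 unlock /= /det3 !ffunE /=; ring.
- by move=> i j k nP; rewrite std_vec_tri model_tri_unlisted.
Qed.

(** * The presented algebra has the required properties *)

(** The indices are listed by increasing weight. *)
Definition sb5_enum : seq (sb_index 5) :=
  [:: 'y_5; 'y_4; 'y_3; 'y_2; 'y_1; 'x_1; 'x_2; 'x_3; 'x_4; 'x_5].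

Lemma mem_sb5_enum i : i \in sb5_enum.
Proof. by case: i => [] [[|[|[|[|[|i]]]]] lti5]. Qed.

Lemma sb5_all (p : pred (sb_index 5)) : all p sb5_enum -> forall i, p i.
Proof. by move=> /allP pP i; apply: pP; apply: mem_sb5_enum. Qed.

(** The largest m for which L^m contains the basis element. *)
Definition wt (i : sb_index 5) : nat :=
  match i with inl j => nth 0 [:: 4; 5; 6; 7; 7] j | inr j => nth 0 [:: 4; 3; 2; 1; 1] j end.

Lemma wt_dual i : (wt i + wt (sb_dual i) = 8)%N.
Proof. by apply/eqP; move: i; apply: sb5_all. Qed.

Lemma wt_gt0 i : (0 < wt i)%N.
Proof. by move: i; apply: sb5_all. Qed.

Definition listed (F : fieldType) (i j k : sb_index 5) : bool :=
  has (fun r => perm_eq [:: i; j; k] [:: r.1.1.1; r.1.1.2; r.1.2]) (P10_2_7 F).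

Section PresentedP10.
Variables (F : fieldType) (L : saa F) (b : sb_index 5 -> L).
Hypothesis sb : standard_basis b.
Hypothesis tri_listed : forall i j k c, (i, j, k, c) \in P10_2_7 F -> '(b i ** b j, b k) = c.
Hypothesis tri_unlisted : forall i j k,
  (forall i' j' k' c, (i', j', k', c) \in P10_2_7 F ->
    ~~ perm_eq [:: i; j; k] [:: i'; j'; k']) -> '(b i ** b j, b k) = 0.
Local Notation pow := (saa_pow L).
Local Notation sgn := (sb_sign F).

Lemma tri_neq0 i j k : ('(b i ** b j, b k) != 0) = listed F i j k.
Proof.
apply/idP/idP => [|/hasP[[[[i' j'] k'] c] rP /= ijk]].
  move=> tri0; apply: contraNT tri0 => /hasPn nlisted.
  by apply/eqP/tri_unlisted => i' j' k' c /nlisted.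
pattern i, j, k; apply: (perm_eq_triple ijk).
- rewrite (tri_listed rP); move: rP; rewrite !inE => /or4P[] /eqP[_ _ _ ->]; exact: oner_neq0.
- by move=> x y z; rewrite (tri_swap12 (b x)) oppr_eq0.
- by move=> x y z; rewrite (tri_swap23 (b x) (b y)) oppr_eq0.
Qed.

(** The claim is symmetrised in order to be stable under permutations: any two of
    the three weights have sum at most 7. *)
Lemma listed_wt i j k : listed F i j k -> (wt i + wt k <= 7)%N.
Proof.
move=> /hasP[r rP ijk].
suff [] : [/\ wt i + wt j <= 7, wt i + wt k <= 7 & wt j + wt k <= 7]%N by [].
pattern i, j, k; apply: (perm_eq_triple ijk).
- by move: rP; rewrite !inE => /or4P[] /eqP ->.
- by move=> x y z [? ? ?]; rewrite addnC.
- by move=> x y z [? ? ?]; rewrite [(wt z + _)%N]addnC.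
Qed.

(** Together with [wt_dual] this says that L^m is contained in the span of the
    basis elements of weight at least m.  In the induction step, T(u,w,b_k) is
    expanded over the basis elements b_l in u: a nonzero T(b_l,w,b_k) requires
    wt l + wt k <= 7, and then the coefficient of b_l vanishes by induction. *)
Lemma pow_filtration m v k : v \in pow m.+1 -> (9 <= wt k + m.+1)%N -> '(v, b k) = 0.
Proof.
elim: m v k => [|m IH] v k.
  move=> _; have := wt_dual k; have := wt_gt0 (sb_dual k); lia.
move=> + le9; suff /subvP s : (pow m.+2 <= orth <[b k]>)%VS.
  by move=> /s /orthP/(_ _ (memv_line _)).
rewrite saa_powS; apply/saa_prodvP => u w um _; apply/orthP => _ /vlineP[q ->].
rewrite linearZr_LR /=.
elim/(standard_basis_ind sb): w => [|p w1 w2 H1 H2|j].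
- by rewrite linear0r linear0l mulr0.
- move: H1 H2; rewrite linearPr linearPl /= mulrDr mulrCA => -> ->.
  by rewrite mulr0 addr0.
rewrite (standard_basis_coord sb u) linear_sumlz linear_sumlz big1 ?mulr0 // => l _.
rewrite linearZl_LR linearZl_LR /=.
have [-> | ] := eqVneq '(b l ** b j, b k) 0; first by rewrite mulr0.
rewrite tri_neq0 => /listed_wt lk; rewrite IH ?mulr0 ?mul0r //.
by have := wt_dual l; lia.
Qed.

Lemma presented_pow8 : pow 8 = 0%VS.
Proof.
apply/eqP; rewrite -subv0; apply/subvP => v v8; rewrite memv0 (standard_basis_coord sb v).
apply/eqP; apply: big1 => i _; rewrite (pow_filtration v8) ?mulr0 ?scale0r //.
by have := wt_gt0 (sb_dual i); lia.
Qed.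

Lemma pow_coord m v : v \in pow m.+1 ->
  v = \sum_(i | (m < wt i)%N) (sgn i * '(v, b (sb_dual i))) *: b i.
Proof.
move=> vm; rewrite {1}(standard_basis_coord sb v) [LHS](bigID (fun i => m < wt i)%N) /=.
rewrite [X in _ + X]big1 ?addr0 // => i wti.
rewrite (pow_filtration vm) ?mulr0 ?scale0r //.
by have := wt_dual i; lia.
Qed.

(** If {i,j} is contained in exactly one listed triple, with third entry l, then
    b_i b_j has a single nonzero coordinate, along the dual of b_l. *)
Lemma mul_basis i j l : all (fun k => listed F i j k == (k == l)) sb5_enum ->
  exists k, b (sb_dual l) = k *: (b i ** b j).
Proof.
move=> /sb5_all uniq_l; set q := '(b i ** b j, b l).
have q0 : q != 0 by rewrite tri_neq0 (eqP (uniq_l l)).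
exists (sgn (sb_dual l) / q); rewrite (standard_basis_coord sb (b i ** b j)).
rewrite (bigD1 (sb_dual l)) //= sb_dualK big1 => [|k kl].
  by rewrite addr0 scalerA -/q mulrA mulrAC divfK // sb_sign_sq scale1r.
have : '(b i ** b j, b (sb_dual k)) == 0.
  rewrite -[_ == 0]negbK tri_neq0 (eqP (uniq_l _)).
  by apply: contra kl => /eqP <-; rewrite sb_dualK.
by move/eqP => ->; rewrite mulr0 scale0r.
Qed.

Lemma basis_pow_step i j l m : all (fun k => listed F i j k == (k == l)) sb5_enum ->
  b i \in pow m.+1 -> b (sb_dual l) \in pow m.+2.
Proof. by move=> /mul_basis[k ->] bi; rewrite memvZ ?saa_pow_mul. Qed.

Lemma basis_pow i : b i \in pow (wt i).
Proof.
have y5 : b 'y_5 \in pow 1 by apply: memvf.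
have y4 : b 'y_4 \in pow 1 by apply: memvf.
have y3 : b 'y_3 \in pow 2 by apply: (@basis_pow_step 'y_5 'y_4 'x_3).
have y2 : b 'y_2 \in pow 3 by apply: (@basis_pow_step 'y_3 'y_5 'x_2).
have y1 : b 'y_1 \in pow 4 by apply: (@basis_pow_step 'y_2 'y_4 'x_1).
have x1 : b 'x_1 \in pow 4 by apply: (@basis_pow_step 'y_2 'y_3 'y_1).
have x2 : b 'x_2 \in pow 5 by apply: (@basis_pow_step 'x_1 'y_4 'y_2).
have x3 : b 'x_3 \in pow 6 by apply: (@basis_pow_step 'x_2 'y_5 'y_3).
have x4 : b 'x_4 \in pow 7 by apply: (@basis_pow_step 'x_3 'y_5 'y_4).
have x5 : b 'x_5 \in pow 7 by apply: (@basis_pow_step 'x_3 'y_4 'y_5).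
have /allP ok : all (fun i => b i \in pow (wt i)) sb5_enum.
  by rewrite /= y5 y4 y3 y2 y1 x1 x2 x3 x4 x5.
exact: ok (mem_sb5_enum i).
Qed.

(** The other basis elements are dual to elements of L^2, the orthogonal of the
    center. *)
Lemma presented_center : saa_center L = (<[b 'x_4]> + <[b 'x_5]>)%VS.
Proof.
apply/eqP; rewrite eqEsubv subv_add -!memvE; apply/andP; split; last first.
  apply/andP; split; apply/saa_centerP => u;
    by apply: (mul_pow0 (i := 6) (j := 0)); rewrite ?memvf ?presented_pow8 //; apply: (basis_pow _).
apply/subvP => v; rewrite center_orth => /orthP v2.
rewrite (standard_basis_coord sb v); apply: memv_suml => i _.
have [le2 | lt2] := leqP 2 (wt (sb_dual i)).
  by rewrite v2 ?mulr0 ?scale0r ?mem0v // (saa_pow_weaken _ (basis_pow _)).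
have : (i == 'x_4) || (i == 'x_5).
  have : (wt (sb_dual i) < 2)%N ==> ((i == 'x_4) || (i == 'x_5)) by move: {lt2}i; apply: sb5_all.
  by rewrite lt2.
case/orP => /eqP ->; apply: memvZ.
  by apply: (subvP (addvSl _ _)); apply: memv_line.
by apply: (subvP (addvSr _ _)); apply: memv_line.
Qed.

Lemma presented_characterized :
    [/\ \dim (fullv : {vspace L}) = 10%N,
        saa_nilpotent L /\ saa_class L 7,
        saa_isotropic (saa_center L) /\ \dim (saa_center L) = 2%N,
        saa_pow L 4 *v saa_pow L 3 <> saa_pow L 7
      & ~~ (saa_pow L 5 *v saa_pow L 2 <= saa_pow L 4 *v saa_pow L 3)%VS].
Proof.
have sf := standard_basis_form sb.
have p8 := presented_pow8.
have p7Z u v : u \in pow 7 -> u ** v = 0.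
  by move=> u7; apply: (mul_pow0 (i := 6) (j := 0)); rewrite ?memvf.
have x55 : '(b 'x_5, b 'y_5) = 1 by rewrite (sf _ 'x_5) mul1r.
have x4in : b 'x_4 \in pow 7 := basis_pow 'x_4.
have x5in : b 'x_5 \in pow 7 := basis_pow 'x_5.
split.
- have [bb _ _ _] := sb.
  by rewrite -(span_basis bb) (eqP (basis_free bb)) size_codom card_sum card_ord.
- split; first by exists 7.
  split=> // m pm; rewrite leqNgt; apply/negP => ltm7.
  have : b 'x_5 \in pow m.+1 by apply: (saa_pow_weaken _ x5in).
  by rewrite pm memv0 => /eqP x50; move: x55; rewrite x50 linear0l => /esym/eqP; rewrite oner_eq0.
- split.
    move=> u v; rewrite {1}center_orth => /orthP u2.
    rewrite presented_center => /memv_addP[_ /vlineP[k ->] [_ /vlineP[l ->] ->]].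
    by apply: u2; apply: memvD; apply: memvZ; apply: (saa_pow_weaken (n := 7)).
  have -> : saa_center L = <<[:: b 'x_4; b 'x_5]>>%VS.
    by rewrite presented_center span_cons span_seq1.
  apply/eqP; rewrite -[2%N]/(size [:: b 'x_4; b 'x_5]) -/(free _).
  rewrite free_cons seq1_free span_seq1; apply/andP; split.
    apply/vlineP => -[k x4E]; have := sf 'x_4 'x_4.
    by rewrite x4E linearZl_LR /= (sf 'x_5 'x_4) mulr0 mulr0 mul1r => /esym/eqP; rewrite oner_eq0.
  by apply/eqP => x50; move: x55; rewrite x50 linear0l => /esym/eqP; rewrite oner_eq0.
(* x3 = +-y1 y2 lies in the product of L^4 and L^3 but is not central *)
- move=> V7; have : b 'x_3 \in pow 7.
    rewrite -V7; have [k ->] : exists k, b 'x_3 = k *: (b 'y_1 ** b 'y_2).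
      by apply: (mul_basis (l := 'y_3)).
    by apply: memvZ; apply: saa_memv_mul; apply: basis_pow.
  move=> /p7Z x34.
  have : '(b 'x_3 ** b 'y_4, b 'y_5) != 0 by rewrite tri_neq0.
  by rewrite x34 linear0l eqxx.
(* x5 = +-x2 y3 is not orthogonal to y5, whereas the product of L^4 and L^3 is *)
apply/subvPn; exists (b 'x_5).
  have [k ->] : exists k, b 'x_5 = k *: (b 'x_2 ** b 'y_3) by apply: (mul_basis (l := 'y_5)).
  by apply: memvZ; apply: saa_memv_mul; apply: basis_pow.
apply/negP => x5V.
suff /subvP/(_ _ x5V)/orthP/(_ _ (memv_line _)) : (pow 4 *v pow 3 <= orth <[b 'y_5]>)%VS.
  by rewrite x55 => /eqP; rewrite oner_eq0.
apply/saa_prodvP => u v /pow_coord -> /pow_coord ->; apply/orthP => _ /vlineP[q ->].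
rewrite linearZr_LR /= linear_sumlz linear_sumlz big1 ?mulr0 // => i wti.
rewrite linear_sumr linear_sumlz big1 // => j wtj.
rewrite !(linearZl_LR, linearZr_LR) /=.
suff /eqP -> : '(b i ** b j, b 'y_5) == 0 by rewrite !mulr0.
rewrite -[_ == 0]negbK tri_neq0; move: i wti j wtj.
have := sb5_all (p := fun i => all (fun j => (3 < wt i)%N ==> (2 < wt j)%N ==>
  ~~ listed F i j 'y_5) sb5_enum) isT.
by move=> ok i wti j wtj; move: (ok i) => /sb5_all/(_ j); rewrite wti wtj.
Qed.

End PresentedP10.

(** * Normalised generators satisfy the presentation *)

Definition word_basis (F : fieldType) (L : saa F) (a b : L) (i : sb_index 5) : L :=
  match i with
  | inl j => nth 0 [:: x1_of a b; x2_of a b; x3_of a b; x4_of a b; x5_of a b] j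
  | inr j => nth 0 [:: y1_of a b; y2_of a b; y3_of a b; a; b] j
  end.

Lemma word_basis_pow (F : fieldType) (L : saa F) (a b : L) i :
  word_basis a b i \in saa_pow L (wt i).
Proof.
move: i; apply: sb5_all.
by rewrite /= !(y3_pow, y2_pow, y1_pow, x1_pow, x2_pow, x3_pow, x4_pow, x5_pow) !memvf.
Qed.

Section Normal.
Variables (F : fieldType) (L : saa F) (a b : L).
Hypotheses (dimL : \dim (fullv : {vspace L}) = 10%N).
Hypotheses (pow8 : saa_pow L 8 = 0%VS).
Local Notation pow := (saa_pow L).
Local Notation form0 := (form0 pow8).
Local Notation tri0 := (tri0 pow8).
Local Notation c := (y3_of a b).
Local Notation d := (y2_of a b).
Local Notation e := (y1_of a b).
Local Notation f := (x1_of a b).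
Local Notation w := (word_basis a b).
Hypothesis fe : '(f, e) = 1.
Hypothesis bd5 : b ** d \in pow 5.
Hypothesis ac5 : a ** c \in pow 5.
Hypothesis acd : '(a ** c, d) = 0.
Hypothesis ab : '(a, b) = 0.

Let c2 : c \in pow 2 := y3_pow a b.
Let d3 : d \in pow 3 := y2_pow a b.
Let e4 : e \in pow 4 := y1_pow a b.
Let f4 : f \in pow 4 := x1_pow a b.
Let x25 := x2_pow a b.
Let x36 := x3_pow a b.
Let x47 := x4_pow a b.
Let x57 := x5_pow a b.

Lemma tri_shift (u v z : L) : '(u ** v, z) = '(z ** u, v).
Proof. by rewrite -tri_cyc. Qed.

Lemma x2_y2_form : '(x2_of a b, d) = 1.
Proof. by rewrite tri_shift mul_skew linearNl /= -form_skew. Qed.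

Lemma x2_y3_form : '(x2_of a b, c) = 0.
Proof. by rewrite tri_shift mul_skew linearNl /= (form0 (i := 5) (j := 4)) ?oppr0. Qed.

Lemma x3_y3_form : '(x3_of a b, c) = 1.
Proof. by rewrite tri_shift mul_skew linearNl /= -form_skew x2_y2_form. Qed.

Lemma x4_y4_form : '(x4_of a b, a) = 1.
Proof. by rewrite tri_shift mul_skew linearNl /= -form_skew x3_y3_form. Qed.

Lemma x5_y5_form : '(x5_of a b, b) = 1.
Proof. by rewrite tri_cyc mul_skew linearNl /= -form_skew x3_y3_form. Qed.

Lemma word_symplectic : symplectic_family w.
Proof.
apply/symplectic_familyP; split.
- move=> i j; have [-> | ij] := eqVneq i j; first exact: saa_form_alt.
  apply: (form0 (i := wt (inl i)) (j := wt (inl j))); rewrite ?wt_gt0 ?word_basis_pow //.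
  by case: i j ij => [[|[|[|[|[|i]]]]] ?] [[|[|[|[|[|j]]]]] ?].
- have ord : forall i j : 'I_5, (i < j)%N -> '(w (inr i), w (inr j)) = 0.
    case=> [[|[|[|[|[|i]]]]] ?] [[|[|[|[|[|j]]]]] ?] //= _.
    + exact: tri_alt23.
    + by rewrite tri_swap23 acd oppr0.
    + exact: tri_alt13.
    + by rewrite tri_shift form_skew tri_alt23 oppr0.
    + exact: tri_alt23.
    + by rewrite tri_shift mul_skew linearNl /= saa_form_alt oppr0.
    + exact: tri_alt13.
    + exact: tri_alt23.
    + exact: tri_alt13.
  move=> i j; case: (ltngtP i j) => [/ord // | /ord ji | /val_inj ->].
    by rewrite form_skew ji oppr0.
  exact: saa_form_alt.
case=> [[|[|[|[|[|i]]]]] ?] [[|[|[|[|[|j]]]]] ?] //=;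
  try by [apply: (form0 (i := 5) (j := 4)) | apply: (form0 (i := 6) (j := 4))
    | apply: (form0 (i := 6) (j := 3)) | apply: (form0 (i := 7) (j := 4))
    | apply: (form0 (i := 7) (j := 3)) | apply: (form0 (i := 7) (j := 2))].
- exact: tri_alt13.
- exact: tri_alt23.
- by rewrite tri_cyc tri_swap12 acd oppr0.
- by rewrite tri_cyc mul_skew linearNl /= saa_form_alt oppr0.
- exact: x2_y2_form.
- exact: x2_y3_form.
- exact: tri_alt13.
- by rewrite tri_shift form_skew tri_alt23 oppr0.
- exact: x3_y3_form.
- by rewrite tri_shift mul_skew linearNl /= -form_skew x2_y3_form.
- exact: tri_alt13.
- exact: x4_y4_form.
- exact: tri_alt13.
- exact: tri_alt23.
- exact: x5_y5_form.
Qed.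

(** The triple vanishes if the two largest weights have sum at least 8.  Of the
    twenty other increasing triples four are listed; in the remaining ones the
    product of two of the entries is, up to sign, a word of the basis or one of
    b y2, a y3, so that the value is known from the form. *)
Lemma word_tri_ranked p q r : (p < q < r)%N -> (r < 10)%N ->
  ~~ listed F (nth 'y_5 sb5_enum p) (nth 'y_5 sb5_enum q) (nth 'y_5 sb5_enum r) ->
  '(w (nth 'y_5 sb5_enum p) ** w (nth 'y_5 sb5_enum q), w (nth 'y_5 sb5_enum r)) = 0.
Proof.
move=> pqr r10 unlisted.
have [heavy | light] := leqP 8 (wt (nth 'y_5 sb5_enum q) + wt (nth 'y_5 sb5_enum r)).
  by rewrite tri_cyc; apply: (tri0 _ heavy); rewrite ?wt_gt0 ?word_basis_pow.
have : (p, q, r) \in [:: (0, 1, 2); (0, 1, 3); (0, 1, 4); (0, 1, 5); (0, 1, 6);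
    (0, 2, 3); (0, 2, 4); (0, 2, 5); (1, 2, 3); (1, 2, 4); (1, 2, 5); (1, 2, 6);
    (0, 3, 4); (0, 3, 5); (1, 3, 4); (2, 3, 5)]%N.
  case/andP: pqr => pq; move: r10 => + qr; move: qr pq unlisted light.
  case: r => [|[|[|[|[|[|[|[|[|[|r]]]]]]]]]] //; case: q => [|[|[|[|[|[|[|[|[|q]]]]]]]]] //;
  by case: p => [|[|[|[|[|[|[|[|[|p]]]]]]]]].
have sf := word_symplectic; have [xx yy xy] := (symplectic_familyP _).2 sf.
have neg u v : '(u, v) = 0 -> '(v, u) = 0 by move=> uv; rewrite form_skew uv oppr0.
have form54 u v : u \in pow 5 -> v \in pow 4 -> '(u, v) = 0.
  exact: (form0 (i := 5) (j := 4)).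
rewrite !inE; do 15?[case/orP]; move=> /eqP[-> -> ->].
- exact: saa_form_alt.
- exact: (yy (@Ordinal 5 2 isT) (@Ordinal 5 1 isT)).
- exact: (yy (@Ordinal 5 2 isT) (@Ordinal 5 0 isT)).
- apply: neg; exact: (xy (@Ordinal 5 0 isT) (@Ordinal 5 2 isT)).
- apply: neg; exact: (xy (@Ordinal 5 1 isT) (@Ordinal 5 2 isT)).
- exact: saa_form_alt.
- exact: (yy (@Ordinal 5 1 isT) (@Ordinal 5 0 isT)).
- apply: neg; exact: (xy (@Ordinal 5 0 isT) (@Ordinal 5 1 isT)).
- exact: acd.
- exact: form54.
- exact: form54.
- by apply: form54 => //; apply: (saa_pow_weaken (n := 5)).
- exact: form54.
- exact: form54.
- exact: saa_form_alt.
by rewrite mul_skew linearNl /= saa_form_alt oppr0.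
Qed.

(** As T is alternating, it is enough to consider triples of increasing rank. *)
Lemma word_presented : saa_presented_by (P10_2_7 F) L.
Proof.
have sf := word_symplectic; have [xx yy xy] := (symplectic_familyP _).2 sf.
exists w; split; first by split=> //; apply: symplectic_family_basis.
  move=> i j k g; rewrite !inE => /or4P[] /eqP[-> -> -> ->] /=.
  - by rewrite tri_shift x3_y3_form.
  - exact: x5_y5_form.
  - by rewrite tri_shift x2_y2_form.
  - by rewrite tri_cyc fe.
move=> i j k nP.
pose le_rank i j := (index i sb5_enum <= index j sb5_enum)%N.
have sorted_ijk : sorted le_rank (sort le_rank [:: i; j; k]).
  by apply: sort_sorted => x y; apply: leq_total.
have : perm_eq [:: i; j; k] (sort le_rank [:: i; j; k]) by rewrite perm_sym perm_sort.
move: sorted_ijk; have := size_sort le_rank [:: i; j; k].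
case: (sort _ _) => [|i' [|j' [|k' [|]]]] //= _ /and3P[ij jk _] ijk.
have [s ->] := tri_perm F ijk.
have [-> | nij] := eqVneq i' j'; first by rewrite saa_mul_alt linear0l mulr0.
have [-> | njk] := eqVneq j' k'; first by rewrite tri_alt23 mulr0.
have rank x : x = nth 'y_5 sb5_enum (index x sb5_enum) by rewrite nth_index ?mem_sb5_enum.
have lt_rank x y : le_rank x y -> x != y -> (index x sb5_enum < index y sb5_enum)%N.
  rewrite /le_rank ltn_neqAle => -> nxy; rewrite andbT; apply: contra nxy => /eqP xy_rank.
  by rewrite (rank x) (rank y) xy_rank.
rewrite (rank i') (rank j') (rank k') word_tri_ranked ?mulr0 ?lt_rank //.
  by rewrite -[10%N]/(size sb5_enum) index_mem mem_sb5_enum.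
rewrite -!rank; apply/hasPn => -[[[x y] z] g] /nP /=.
by rewrite (permPl ijk).
Qed.

End Normal.

Theorem proposition8p11 (F : fieldType) :
  let characterized (L : saa F) :=
    [/\ \dim (fullv : {vspace L}) = 10%N,
        saa_nilpotent L /\ saa_class L 7,
        saa_isotropic (saa_center L) /\ \dim (saa_center L) = 2%N,
        saa_pow L 4 *v saa_pow L 3 <> saa_pow L 7
      & ~~ (saa_pow L 5 *v saa_pow L 2 <= saa_pow L 4 *v saa_pow L 3)%VS] in
  exists L : saa F,
    [/\ characterized L,
        forall M : saa F, characterized M -> saa_isomorphic M L
      & saa_presented_by (P10_2_7 F) L].
Proof.
move=> characterized; exists (model (P10_2_7 F)).
have presL := model_P10 F; split=> // [|M].
  by have [b [sb bP b0]] := presL; apply: presented_characterized sb bP b0.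
move=> [dimM [_ [pow8 class7]] [_ dimZ] _ notin_pow4_mul_pow3].
have pow7 : saa_pow M 7 <> 0%VS by move=> /class7.
have [a [b [_ fe bd5 ac5 [acd ab]]]] :=
  exists_normal_generators dimM pow8 pow7 dimZ notin_pow4_mul_pow3.
by apply: presented_isomorphic presL; apply: word_presented fe bd5 ac5 acd ab.
Qed.
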